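(* Let $N\ge 1$ be an integer, $f_s>0$, let $x(t)$ be an input signal with Fourier transform $X(f)$, and let $\mathbf{o}=(o_0,\dots,o_{N-1})\in\mathbb{R}^N$ be the offset sequence, where $o_n$ is the offset of the $n$th of the $N$ sub-ADCs of an interleaved ADC of total rate $f_s$. Let $y^{\mathrm{id}}(t)=x(t)\sum_{k\in\mathbb{Z}}\delta\left(t-\frac{k}{f_s}\right)$ be the ideally sampled output, with Fourier transform $Y^{\mathrm{id}}(f)$, and let the output of the interleaved ADC with offsets be $$y^{\mathrm{o}}(t)=y^{\mathrm{id}}(t)+\sum_{k\in\mathbb{Z}}o_{k \bmod N}\,\delta\left(t-\frac{k}{f_s}\right).$$ Then the Fourier transform $Y^{\mathrm{o}}$ of $y^{\mathrm{o}}$ is $$Y^{\mathrm{o}}(f)=Y^{\mathrm{id}}(f)+f_s\sum_{k\in\mathbb{Z}}\tilde{o}_{k\bmod N}\,\delta\left(f-k\frac{f_s}{N}\right),$$ where $\tilde{\mathbf{o}}$ is the normalized DFT of $\mathbf{o}$.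
   Context: The Fourier transform is $X(f)=\int x(t)e^{-2\pi j f t}\,dt$, with $j$ the imaginary unit, and $\delta$ is the Dirac distribution. For $\mathbf{u}\in\mathbb{C}^N$ with entries $u_0,\dots,u_{N-1}$, the normalized DFT is $\tilde u_k=\frac1N\sum_{n=0}^{N-1}e^{-2\pi j kn/N}u_n$ for $k=0,\dots,N-1$. The index $k\bmod N$ is taken in $\{0,\dots,N-1\}$. *)

(* Defs.v *)
From HB Require Import structures.
From mathcomp Require Import all_boot all_order all_algebra.
From mathcomp Require Import complex.
From mathcomp Require Import all_classical all_reals all_analysis.
Set Implicit Arguments.
Unset Strict Implicit.
Unset Printing Implicit Defensive.
Import Order.TTheory GRing.Theory Num.Theory.
Import numFieldNormedType.Exports.
Local Open Scope classical_set_scope.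
Local Open Scope complex_scope.
Local Open Scope ring_scope.

Section ComplexAnalysis.
Context {R : realType}.
Local Notation Re := (@complex.Re R).
Local Notation Im := (@complex.Im R).
Implicit Types (f : R -> R[i]) (a : int -> R[i]).

Definition expi (theta : R) : R[i] := cos theta +i* sin theta.

Definition csmooth f :=
  forall (n : nat) (t : R), derivable (derive1n n (Re \o f)) t 1 /\
                            derivable (derive1n n (Im \o f)) t 1.

Definition cderiv (n : nat) f (t : R) : R[i] :=
  derive1n n (Re \o f) t +i* derive1n n (Im \o f) t.

Definition cintegrable f :=
  (@lebesgue_measure R).-integrable setT (EFin \o (Re \o f)) /\
  (@lebesgue_measure R).-integrable setT (EFin \o (Im \o f)).

Definition cintegral f : R[i] :=
  Rintegral (@lebesgue_measure R) setT (Re \o f) +i*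
  Rintegral (@lebesgue_measure R) setT (Im \o f).

(* A series indexed by int is split into its terms of index n >= 0 (Posz n)
   and of index - n.+1 (Negz n); both halves must converge. *)
Definition cvgZ_real (a : int -> R) :=
  cvgn (series (fun n : nat => a (Posz n))) /\
  cvgn (series (fun n : nat => a (Negz n))).

Definition sumZ_real (a : int -> R) : R :=
  limn (series (fun n : nat => a (Posz n))) +
  limn (series (fun n : nat => a (Negz n))).

Definition cvgZ a :=
  cvgZ_real (Re \o a) /\ cvgZ_real (Im \o a).

(* Meaningful only when cvgZ a holds. *)
Definition sumZ a : R[i] :=
  sumZ_real (Re \o a) +i* sumZ_real (Im \o a).

End ComplexAnalysis.

Section TemperedDistributions.
Context {R : realType}.
Implicit Types (phi psi x : R -> R[i]).

Definition seminorm_values (p q : nat) phi : set R :=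
  range (fun t : R => `|t| ^+ p * Normc.normc (cderiv q phi t)).

Definition schwartz phi :=
  csmooth phi /\ forall p q : nat, has_ubound (seminorm_values p q phi).

Definition seminorm (p q : nat) phi : R := sup (seminorm_values p q phi).

(* Distributions are represented by functionals defined on all functions
   R -> R[i]; only their values on Schwartz functions are meaningful.  Having
   them defined on all functions allows products with a non-smooth signal and
   pointwise sums to be written as functionals. *)
Definition functional := (R -> R[i]) -> R[i].
Implicit Types S T : functional.

Definition tempered T :=
  (forall (c : R[i]) phi psi, schwartz phi -> schwartz psi ->
     T (fun t => c * phi t + psi t) = c * T phi + T psi) /\
  (exists (m : nat) (C : R), forall phi, schwartz phi ->
     Normc.normc (T phi)
       <= C * \sum_(p < m.+1) \sum_(q < m.+1) seminorm p q phi).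

Definition dirac_delta (s : R) : functional := fun phi => phi s.

Definition dist_add S T : functional := fun phi => S phi + T phi.

Definition dist_scale (c : R[i]) T : functional := fun phi => c * T phi.

Definition dist_mul x T : functional := fun phi => T (fun t => x t * phi t).

(* Convergence of a series of distributions is weak convergence, i.e.,
   convergence after evaluation at every Schwartz function. *)
Definition dist_summable (T_ : int -> functional) :=
  forall phi, schwartz phi -> cvgZ (fun k => T_ k phi).

Definition dist_sumZ (T_ : int -> functional) : functional :=
  fun phi => sumZ (fun k => T_ k phi).

Definition regular_dist x : functional :=
  fun phi => cintegral (fun t => x t * phi t).

Definition fourier phi : R -> R[i] :=
  fun f => cintegral (fun t => phi t * expi (- (2 * pi * f * t))).

(* The Fourier transform of a tempered distribution, by duality; S is
   determined by T as a distribution, i.e., on Schwartz functions. *)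
Definition is_fourier T S :=
  tempered T /\ forall phi, schwartz phi -> S phi = T (fourier phi).

(* The Fourier transform of a signal is that of the distribution it defines, so
   that signals that are not integrable (sinusoids, say) are allowed. *)
Definition is_signal_fourier x S :=
  (forall phi, schwartz phi -> cintegrable (fun t => x t * phi t)) /\
  is_fourier (regular_dist x) S.

End TemperedDistributions.

Section DFT.
Context {R : realType}.

Definition dft (N : nat) (u : 'rV[R[i]]_N) : 'rV[R[i]]_N :=
  \row_(k < N) ((N%:R)^-1 *
    \sum_(n < N) expi (- (2 * pi * (k%:R * n%:R) / N%:R)) * u 0 n).

End DFT.

Lemma modZ_proof (N : nat) (hN : (0 < N)%N) (k : int) :
  (`|(k %% N)%Z| < N)%N.
Proof.
have N0 : (N : int) != 0 by rewrite eqz_nat -lt0n.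
by rewrite -ltz_nat gez0_abs ?modz_ge0// ltz_pmod.
Qed.

Definition modZ (N : nat) (hN : (0 < N)%N) (k : int) : 'I_N :=
  Ordinal (modZ_proof hN k).

(* Main.v *)
(* By inverting the DFT of the offsets, the claim reduces to Poisson summation,
   for a Schwartz function phi, at the nodes a + P l with a = m fs / N, P = fs.

   Poisson summation follows Chernoff's proof of pointwise Fourier inversion.
   Let step be the function equal on each cell to the value of phi at its node.
   Its Fourier coefficients vanish except the constant one, P * sum phi(a + P l).
   By the mean value theorem phi - step = 2 sin(pi (t - a) / P) quot(t), with
   quot dominated by an integrable step function, so that the coefficients of
   phi - step telescope into coefficients of quot; these tend to 0 by Bessel's
   inequality.  This also makes each half of the bilateral series converge, so
   that the decay of the Fourier transform of phi is never needed. *)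

Require Import Defs.
From HB Require Import structures.
From mathcomp Require Import all_boot all_order all_algebra.
From mathcomp Require Import complex.
From mathcomp Require Import zify ring lra.
From mathcomp Require Import all_classical all_reals all_analysis.
From mathcomp Require Import measurable_realfun.
Import Order.TTheory GRing.Theory Num.Theory.
Import numFieldNormedType.Exports.
Local Open Scope complex_scope.
Local Open Scope ring_scope.

(** Comparing Fourier coefficients after periodizing [phi] would require an interchange of sum and
    integral. Everything stays on the line instead, cut into cells of one period: the integral of a
    step function is [P] times the sum of its values, while every nonconstant harmonic of period [P]
    integrates to 0 over each cell. The sine by which [phi - step] is divided has period [2 * P], so
    the quotient is tested against odd multiples of half the base frequency. These are only
    antiperiodic over a cell, but a product of two of them has period [P] again, which suffices for
    Bessel's inequality. The reduction works because the shift of origin by [m fs / N] multiplies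
    the [k]-th coefficient by the exponential of the inverse DFT, while the shifted nodes
    [m fs / N + fs l] are the multiples of [fs / N] whose index is [m] modulo [N]. *)

(** * Cells around the nodes and a summable weight on them *)

Section WeightedStepFunctions.
Set Implicit Arguments.
Unset Strict Implicit.
Local Open Scope classical_set_scope.
Context {R : realType}.
Notation mu := (@lebesgue_measure R).

(** Meant for [quot], whose denominator vanishes at the nodes: inversion is continuous off 0, and
    the point 0 is treated apart. *)
Lemma measurable_inv : measurable_fun setT (@GRing.inv R).
Proof.
have -> : setT = [set 0 : R] `|` ~` [set 0] by rewrite setUv.
apply/measurable_funU => //; first exact: measurableC.
split; first exact: measurable_fun_set1.
apply: open_continuous_measurable_fun.
  by apply: closed_openC; exact: closed_eq.
by move=> x; rewrite inE /= => /eqP x0; exact: inv_continuous.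
Qed.

Variables (a P : R) (P0 : 0 < P).

(* The line is cut into cells of length P centred at the nodes a + P l. *)
Definition phase (t : R) : R := (t - a) / P.

Definition nearest (t : R) : int := Num.floor (phase t + 2^-1).

Definition weight (l : int) : R := (1 + l%:~R ^+ 2)^-1.

Definition node (l : int) : R := a + P * l%:~R.

Lemma weight_gt0 l : 0 < weight l.
Proof. by rewrite invr_gt0 ltr_pwDl // sqr_ge0. Qed.

Lemma weight_ge0 l : 0 <= weight l.
Proof. exact/ltW/weight_gt0. Qed.

Lemma nearest_bounds t l : nearest t = l <->
  node l - P / 2 <= t < node l + P / 2.
Proof.
rewrite /nearest /phase /node.
have key : (Num.floor ((t - a) / P + 2^-1) == l) =
  (a + P * l%:~R - P / 2 <= t < a + P * l%:~R + P / 2).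
  rewrite floor_eq intrD /=; congr andb.
    rewrite -lerBlDr ler_pdivlMr //; apply/idP/idP => h; lra.
  rewrite -ltrBrDr ltr_pdivrMr //; apply/idP/idP => h; lra.
by split=> [/eqP|]; rewrite -?key // => /eqP.
Qed.

Lemma nearest_node l : nearest (node l) = l.
Proof. by apply/nearest_bounds; move: P0; lra. Qed.

Lemma nearest_preimage l :
  [set t | nearest t = l] = `[node l - P / 2, node l + P / 2[.
Proof.
by apply/seteqP; split => t /=; rewrite in_itv /= => /nearest_bounds.
Qed.

Lemma measurable_step (c : int -> R) : measurable_fun setT (c \o nearest).
Proof.
move=> _ B mB; rewrite setTI.
have -> : (c \o nearest) @^-1` B =
  \bigcup_(l : int) (if c l \in B then [set t | nearest t = l] else set0).
  apply/seteqP; split => t /=.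
    by move=> Bt; exists (nearest t) => //; rewrite mem_set.
  by move=> [l _]; case: ifPn => // /set_mem cB /= ->.
apply: countable_bigcupT_measurable => // l.
by case: ifP => // _; rewrite nearest_preimage; exact: measurable_itv.
Qed.

(** On the cell, [t = a + P * l + d] with [|d| <= P / 2], and the square of a sum of three terms is
    at most 3 times the sum of the squares. This direction makes the weight integrable;
    [oneDsqrV_le] turns Schwartz decay into a bound by the weight. *)
Lemma weight_nearest_le t :
  weight (nearest t) <=
  (1 + 3 * a ^+ 2 + 4 * P ^+ 2) * (oneDsqr t)^-1.
Proof.
rewrite /weight; set l := nearest t.
have /nearest_bounds /andP[h1 h2] : nearest t = l by [].
have L0 : 0 < 1 + (l%:~R : R) ^+ 2 by rewrite ltr_pwDl // sqr_ge0.
have T0 : 0 < oneDsqr t by rewrite (lt_le_trans ltr01) // oneDsqr_ge1.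
rewrite -(ler_pM2l L0) divff ?gt_eqF // mulrA ler_pdivlMr // mul1r /oneDsqr.
move: h1 h2; rewrite /node; set L : R := l%:~R => h1 h2.
set d := t - (a + P * L).
have hd : d ^+ 2 <= (P / 2) ^+ 2.
  rewrite -subr_ge0 subr_sqr; apply: mulr_ge0; rewrite /d; lra.
have -> : t = a + P * L + d by rewrite /d; ring.
have h3 : (a + P * L + d) ^+ 2 <= 3 * a ^+ 2 + 3 * (P * L) ^+ 2 + 3 * d ^+ 2.
  have := sqr_ge0 (a - P * L); have := sqr_ge0 (a - d).
  by have := sqr_ge0 (P * L - d); nra.
have a0 := sqr_ge0 a; have L1 := sqr_ge0 L; have p0 := sqr_ge0 P.
have aL : 0 <= a ^+ 2 * L ^+ 2 by apply: mulr_ge0.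
have pL : 0 <= P ^+ 2 * L ^+ 2 by apply: mulr_ge0.
rewrite exprMn in h3; rewrite expr_div_n in hd; lra.
Qed.

(** The same estimate after division by [P]: [l = t / P - a / P + d] with [|d| <= 1 / 2], and the
    constant 2 covers [1 + 3 / 4]. *)
Lemma oneDsqrV_le t :
  (oneDsqr t)^-1 <=
  (2 + 3 * P^-1 ^+ 2 * (1 + a ^+ 2)) * weight (nearest t).
Proof.
rewrite /weight; set l := nearest t.
have /nearest_bounds /andP[h1 h2] : nearest t = l by [].
have L0 : 0 < 1 + (l%:~R : R) ^+ 2 by rewrite ltr_pwDl // sqr_ge0.
have T0 : 0 < oneDsqr t by rewrite (lt_le_trans ltr01) // oneDsqr_ge1.
rewrite -(ler_pM2l T0) divff ?gt_eqF // mulrA ler_pdivlMr // mul1r /oneDsqr.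
move: h1 h2; rewrite /node; set L : R := l%:~R => h1 h2.
set r := P^-1; set d := L + a * r - t * r.
have rP : r * P = 1 by rewrite mulVf // gt_eqF.
have r0 : 0 < r by rewrite invr_gt0.
have e1 : (a + P * L - P / 2) * r = a * r + L * (r * P) - r * P / 2 by ring.
have e2 : (a + P * L + P / 2) * r = a * r + L * (r * P) + r * P / 2 by ring.
have hd : d ^+ 2 <= 2^-1 ^+ 2.
  move/(ler_wpM2r (ltW r0)): h1; move/ltW/(ler_wpM2r (ltW r0)): h2.
  rewrite e1 e2 rP => h2 h1; rewrite -subr_ge0 subr_sqr.
  apply: mulr_ge0; rewrite /d; lra.
have -> : L = t * r + - (a * r) + d by rewrite /d; ring.
have h3 : (t * r + - (a * r) + d) ^+ 2 <=
    3 * (t * r) ^+ 2 + 3 * (a * r) ^+ 2 + 3 * d ^+ 2.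
  have := sqr_ge0 (t * r + a * r); have := sqr_ge0 (t * r - d).
  by have := sqr_ge0 (- (a * r) - d); nra.
have t0 := sqr_ge0 t; have a0 := sqr_ge0 a; have r1 := sqr_ge0 r.
have ar : 0 <= a ^+ 2 * r ^+ 2 by apply: mulr_ge0.
have atr : 0 <= t ^+ 2 * (a ^+ 2 * r ^+ 2) by apply: mulr_ge0.
rewrite !exprMn in h3; lra.
Qed.

Lemma integrable_oneDsqrV :
  mu.-integrable setT (EFin \o (fun t => (oneDsqr t)^-1)).
Proof.
apply/integrableP; split.
  apply/measurable_EFinP; apply: continuous_measurable_fun.
  exact: continuous_oneDsqrV.
apply/abse_integralP => //=.
  apply/measurable_EFinP; apply: continuous_measurable_fun.
  exact: continuous_oneDsqrV.
rewrite ge0_symfun_integralT; last 3 first.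
- by move=> t; rewrite invr_ge0 (le_trans ler01) // oneDsqr_ge1.
- exact: continuous_oneDsqrV.
- by move=> t /=; rewrite /oneDsqr sqrrN.
rewrite (_ : [set x | _] = `[0, +oo[%classic); last first.
  by apply/seteqP; split => x/=; rewrite in_itv/= andbT.
by rewrite integral0y_oneDsqr -EFinM /= ltry.
Qed.

Lemma integrable_le (K : R) (f g : R -> R) : measurable_fun setT f ->
  (forall t, `|f t| <= K * g t) -> mu.-integrable setT (EFin \o g) ->
  mu.-integrable setT (EFin \o f).
Proof.
move=> mf fg ig; have iKg := integrableZl measurableT K ig.
apply: le_integrable iKg => //; first exact/measurable_EFinP.
by move=> t _ /=; rewrite lee_fin (le_trans (fg t)) // ler_norm.
Qed.

Lemma integrable_weight : mu.-integrable setT (EFin \o (weight \o nearest)).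
Proof.
apply: integrable_le (measurable_step weight) _ integrable_oneDsqrV => t /=.
by rewrite ger0_norm ?weight_ge0 //; exact: weight_nearest_le.
Qed.

Lemma integrable_le_weight (K : R) (f : R -> R) : measurable_fun setT f ->
  (forall t, `|f t| <= K * weight (nearest t)) ->
  mu.-integrable setT (EFin \o f).
Proof. by move=> mf fK; exact: integrable_le mf fK integrable_weight. Qed.

End WeightedStepFunctions.

(** * Integration cell by cell, and harmonics against step functions *)

Section StepIntegrals.
Set Implicit Arguments.
Unset Strict Implicit.
Local Open Scope classical_set_scope.
Context {R : realType}.
Notation mu := (@lebesgue_measure R).
Variables (a P : R) (P0 : 0 < P).
Local Notation nearest := (nearest a P).
Local Notation phase := (phase a P).

(** The index runs over [- L <= l < L], since [Negz n] is [- (n + 1)]. The same half-open range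
    defines [block], and it splits exactly into residue classes in [symsum_blocks]. *)
Definition symsum {V : zmodType} (c : int -> V) (L : nat) : V :=
  \sum_(0 <= n < L) c (Posz n) + \sum_(0 <= n < L) c (Negz n).

Lemma symsumS {V : zmodType} (c : int -> V) (L : nat) :
  symsum c L.+1 = symsum c L + (c (Posz L) + c (Negz L)).
Proof. by rewrite /symsum !big_nat_recr //= addrACA. Qed.

Definition cell (l : int) : set R := [set t | nearest t = l].
Definition block (L : nat) : set R := [set t | - L%:Z <= nearest t < L%:Z].

Lemma measurable_cell l : measurable (cell l).
Proof. by rewrite /cell nearest_preimage //; exact: measurable_itv. Qed.

Lemma blockS L : block L.+1 = block L `|` (cell (Posz L) `|` cell (Negz L)).
Proof.
apply/seteqP; split => t /=; rewrite /block /cell /=; set n := nearest t.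
  move=> /andP[h1 h2].
  have [/eqP e|e1] := boolP (n == Posz L); first by right; left.
  have [/eqP e|e2] := boolP (n == Negz L); first by right; right.
  left; apply/andP; split; lia.
by move=> [/andP[h1 h2]|[->|->]]; apply/andP; split; lia.
Qed.

Lemma measurable_block L : measurable (block L).
Proof.
elim: L => [|L IH].
  rewrite (_ : block 0 = set0) //; apply/seteqP; split => t //=.
  by rewrite /block /=; lia.
rewrite blockS; apply: measurableU => //.
by apply: measurableU; exact: measurable_cell.
Qed.

Lemma Rintegral_block (f : R -> R) (L : nat) :
  mu.-integrable setT (EFin \o f) ->
  \int[mu]_(t in block L) f t = symsum (fun l => \int[mu]_(t in cell l) f t) L.
Proof.
move=> fi; elim: L => [|L IH].
  rewrite (_ : block 0 = set0) ?Rintegral_set0.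
    by rewrite /symsum !big_geq // addr0.
  by apply/seteqP; split => t //=; rewrite /block /=; lia.
have mc := measurable_cell; have mb := measurable_block.
have fiS A : measurable A -> mu.-integrable A (EFin \o f).
  by move=> mA; exact: integrableS fi.
have mcc : measurable (cell (Posz L) `|` cell (Negz L)).
  by apply: measurableU; exact: mc.
rewrite blockS symsumS Rintegral_setU ?IH.
- rewrite Rintegral_setU //; [exact: mc|exact: mc|exact: fiS|].
  by apply/disj_setPS => t /= []; rewrite /cell /= => ->.
- exact: mb.
- exact: mcc.
- by apply: fiS; apply: measurableU; [exact: mb|exact: mcc].
- apply/disj_setPS => t /= []; rewrite /block /cell /=.
  by move=> /andP[h1 h2] [] h; move: h1 h2; rewrite h; lia.
Qed.

Lemma cvg_block (f : R -> R) : mu.-integrable setT (EFin \o f) ->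
  (fun L => \int[mu]_(t in block L) f t) @ \oo --> \int[mu]_t f t.
Proof.
move=> fi; have mf : measurable_fun setT f.
  by apply/measurable_EFinP; exact: measurable_int fi.
have ni := integrable_norm fi.
have cvE : (\int[mu]_t ((f \_ (block L)) t)%:E @[L --> \oo] -->
    \int[mu]_t (f t)%:E)%E.
  apply: (@dominated_cvg _ _ _ mu setT measurableT
    (fun L => EFin \o (f \_ (block L))) (EFin \o f) (EFin \o (Num.norm \o f))) => //.
  - move=> L; apply/measurable_EFinP; apply/(measurable_restrictT f) => //.
      exact: measurable_block.
    exact: measurable_funS mf.
  - move=> t _; apply: cvg_near_cst; exists `|nearest t|.+1 => // L /= hL.
    by rewrite patchE mem_set //; rewrite /block /=; lia.
  - move=> L t _ /=; rewrite lee_fin patchE; case: ifP => // _.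
    by rewrite normr0.
have fE : \int[mu]_t f t = fine (\int[mu]_t (f t)%:E)%E by [].
rewrite fE; under eq_fun do rewrite Rintegral_mkcond.
apply: fine_cvg; rewrite fineK //; exact: integrable_fin_num.
Qed.

Lemma cvg_symsum (f : R -> R) : mu.-integrable setT (EFin \o f) ->
  symsum (fun l => \int[mu]_(t in cell l) f t) @ \oo --> \int[mu]_t f t.
Proof.
move=> fi; have := cvg_block fi; apply: cvg_trans; apply: near_eq_cvg.
by apply: nearW => L /=; rewrite Rintegral_block.
Qed.

Lemma Rintegral_step_cell (c : int -> R) (f : R -> R) (l : int) :
  mu.-integrable (cell l) (EFin \o f) ->
  \int[mu]_(t in cell l) (c (nearest t) * f t) =
  c l * \int[mu]_(t in cell l) f t.
Proof.
move=> fi; rewrite -RintegralZl //; last exact: measurable_cell.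
by apply: eq_Rintegral => t; rewrite inE /cell /= => ->.
Qed.

Lemma cell_measure_lty l : (mu (cell l) < +oo)%E.
Proof.
by rewrite /cell nearest_preimage // lebesgue_measure_itv; case: ifP; rewrite ltry.
Qed.

Lemma cell_measure l : fine (mu (cell l)) = P.
Proof.
rewrite /cell nearest_preimage // lebesgue_measure_itv /= lte_fin.
by rewrite ifT -?EFinD /=; move: P0; lra.
Qed.

(** A cell is exactly one period long, so the periodic primitive takes equal values at its two
    ends. *)
Lemma Rintegral_cell_periodic (F f : R -> R) (l : int) :
  (forall t : R, is_derive t 1 F (f t)) -> continuous f ->
  (forall t, F (t + P) = F t) -> \int[mu]_(t in cell l) f t = 0.
Proof.
move=> dF cf FP; rewrite /cell nearest_preimage //.
set A := node a P l - P / 2; set B := node a P l + P / 2.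
have AB : A < B by rewrite /A /B; move: P0; lra.
have BE : B = A + P by rewrite /A /B; lra.
have cF : continuous F.
  by move=> t; apply: differentiable_continuous; apply/derivable1_diffP.
have cfS : {within `[A, B], continuous f} by exact: continuous_subspaceT.
rewrite Rintegral_itv_bndo_bndc; last first.
  apply: integrableS (continuous_compact_integrable _ cfS) => //.
  - by apply: subset_itv; rewrite bnd_simp.
  - exact: segment_compact.
rewrite /Rintegral (@continuous_FTC2 _ f F) //.
- by rewrite BE FP -EFinB subrr.
- split.
  + by move=> t _; apply: ex_derive.
  + by apply: cvg_at_right_filter; exact: cF.
  + by apply: cvg_at_left_filter; exact: cF.
- by move=> t _; rewrite derive1E; exact: derive_val.
Qed.

Lemma integrable_step (c : int -> R) (K : R) (f : R -> R) :
  (forall l, `|c l| <= K * weight l) -> measurable_fun setT f ->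
  (forall t, `|f t| <= 1) ->
  mu.-integrable setT (EFin \o (fun t => c (nearest t) * f t)).
Proof.
move=> cK mf f1; apply: (integrable_le_weight P0 (a := a) (K := K)).
  by apply: measurable_funM => //; exact: measurable_step.
by move=> t; rewrite normrM (le_trans _ (cK (nearest t))) // ler_piMr.
Qed.

(** The step factor leaves the integral over each cell as a constant; what remains is an integral
    over a full period. The bound by the weight gives the integrability that allows the line to be
    summed cell by cell. *)
Lemma Rintegral_step_periodic (c : int -> R) (K : R) (F f : R -> R) :
  (forall l, `|c l| <= K * weight l) ->
  (forall t : R, is_derive t 1 F (f t)) -> continuous f ->
  (forall t, `|f t| <= 1) ->
  (forall t, F (t + P) = F t) -> \int[mu]_t (c (nearest t) * f t) = 0.
Proof.
move=> cK dF cf f1 FP.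
have mf := continuous_measurable_fun cf.
have fi := integrable_step cK mf f1.
have := cvg_symsum fi; rewrite (_ : symsum _ = fun=> 0).
  by move=> /(cvg_lim (@Rhausdorff R)) <-; rewrite lim_cst.
have cell0 l : \int[mu]_(t in cell l) (c (nearest t) * f t) = 0.
  rewrite Rintegral_step_cell ?(Rintegral_cell_periodic _ dF) ?mulr0 //.
  apply: measurable_bounded_integrable.
  - exact: measurable_cell.
  - exact: cell_measure_lty.
  - exact: measurable_funS mf.
  - exists 1; split => // x x1 t _; exact: le_trans (f1 t) (ltW x1).
by apply/funext => L; rewrite /symsum !big1_seq ?addr0 // => n _; rewrite cell0.
Qed.

Lemma cvg_step_total (c : int -> R) (K : R) :
  (forall l, `|c l| <= K * weight l) ->
  (fun L => P * symsum c L) @ \oo --> \int[mu]_t c (nearest t).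
Proof.
move=> cK.
have ci : mu.-integrable setT (EFin \o (c \o nearest)).
  apply: (integrable_le_weight P0 (a := a) (K := K)) => [|t /=].
    exact: measurable_step.
  exact: cK.
have := cvg_symsum ci; apply: cvg_trans; apply: near_eq_cvg; apply: nearW => L.
rewrite /symsum mulrDr !mulr_sumr; congr (_ + _); apply: eq_bigr => n _.
  rewrite (@eq_Rintegral _ _ _ mu _ (fun=> c (Posz n))).
    by rewrite Rintegral_cst ?cell_measure 1?mulrC //; exact: measurable_cell.
  by move=> t; rewrite inE /cell /= => ->.
rewrite (@eq_Rintegral _ _ _ mu _ (fun=> c (Negz n))).
  by rewrite Rintegral_cst ?cell_measure 1?mulrC //; exact: measurable_cell.
by move=> t; rewrite inE /cell /= => ->.
Qed.

(** Indices count half-frequencies: the cosine and sine of [wave j] have period [P] for even [j] and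
    change sign over a cell for odd [j]. The usual [n]-th harmonic is therefore [wave n.*2]. *)
Definition wave (j : nat) (t : R) : R := j%:R * (pi * phase t).

Lemma waveDP j t : wave j (t + P) = wave j t + pi *+ j.
Proof.
rewrite /wave /phase -mulr_natl (_ : t + P - a = t - a + P); last by ring.
by rewrite [(_ + P) / P]mulrDl divff ?gt_eqF //; ring.
Qed.

Lemma continuous_wave j : continuous (wave j).
Proof.
move=> t; apply: cvgMr; apply: cvgMr; apply: cvgMl.
by apply: cvgB; [exact: cvg_id|exact: cvg_cst].
Qed.

Lemma continuous_cos_wave j : continuous (cos \o wave j).
Proof.
by move=> t; apply: continuous_comp; [exact: continuous_wave|exact: continuous_cos].
Qed.

Lemma continuous_sin_wave j : continuous (sin \o wave j).
Proof.
by move=> t; apply: continuous_comp; [exact: continuous_wave|exact: continuous_sin].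
Qed.

Lemma is_derive_wave j (t : R) : is_derive t 1 (wave j) (j%:R * pi / P).
Proof.
have -> : wave j = (j%:R * pi / P) \*: (id - cst a).
  apply/funext => s; rewrite /wave /phase /=.
  by rewrite -[RHS]/(j%:R * pi / P * (s - a)); ring.
by apply: is_derive_eq; rewrite subr0 -[LHS]/(_ * _) mulr1.
Qed.

Lemma is_derive_sin_wave j (t : R) :
  is_derive t 1 (sin \o wave j) (j%:R * pi / P * cos (wave j t)).
Proof.
have := is_derive1_comp (is_derive_sin (wave j t)) (is_derive_wave j t).
by move=> d; apply: (is_derive_eq d); rewrite mulrC.
Qed.

Lemma is_derive_cos_wave j (t : R) :
  is_derive t 1 (cos \o wave j) (j%:R * pi / P * - sin (wave j t)).
Proof.
have := is_derive1_comp (is_derive_cos (wave j t)) (is_derive_wave j t).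
by move=> d; apply: (is_derive_eq d); rewrite mulrC.
Qed.

Lemma wave_evenDP m t : wave m.*2 (t + P) = wave m.*2 t + (pi *+ 2) *+ m.
Proof. by rewrite waveDP -mul2n mulrnA. Qed.

Lemma Rintegral_step_cos (c : int -> R) (K : R) (m : nat) :
  (forall l, `|c l| <= K * weight l) -> (0 < m)%N ->
  \int[mu]_t (c (nearest t) * cos (wave m.*2 t)) = 0.
Proof.
move=> cK m0; set k := m.*2%:R * pi / P.
have k0 : k != 0.
  by rewrite gt_eqF // divr_gt0 // mulr_gt0 ?pi_gt0 // ltr0n double_gt0.
apply: (Rintegral_step_periodic (F := k^-1 \*: (sin \o wave m.*2)) cK).
- move=> t; have d := is_derive_sin_wave m.*2 t.
  by apply: is_derive_eq; rewrite -[LHS]/(_ * _) mulrA mulVf // mul1r.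
- exact: continuous_cos_wave.
- by move=> t; exact: cos_max.
- by move=> t /=; rewrite wave_evenDP (periodicn (@sinD2pi R)).
Qed.

Lemma Rintegral_step_sin (c : int -> R) (K : R) (m : nat) :
  (forall l, `|c l| <= K * weight l) -> (0 < m)%N ->
  \int[mu]_t (c (nearest t) * sin (wave m.*2 t)) = 0.
Proof.
move=> cK m0; set k := m.*2%:R * pi / P.
have k0 : k != 0.
  by rewrite gt_eqF // divr_gt0 // mulr_gt0 ?pi_gt0 // ltr0n double_gt0.
apply: (Rintegral_step_periodic (F := (- k^-1) \*: (cos \o wave m.*2)) cK).
- move=> t; have d := is_derive_cos_wave m.*2 t.
  by apply: is_derive_eq; rewrite -[LHS]/(_ * _) mulNr !mulrN opprK mulrA mulVf // mul1r.
- exact: continuous_sin_wave.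
- by move=> t; exact: sin_max.
- by move=> t /=; rewrite wave_evenDP (periodicn (@cosD2pi R)).
Qed.

End StepIntegrals.

(** * Bessel's inequality for a weighted integral on the line *)

Section WeightedBessel.
Set Implicit Arguments.
Unset Strict Implicit.
Local Open Scope classical_set_scope.
Context {R : realType}.
Notation mu := (@lebesgue_measure R).
Variables (a P : R) (P0 : 0 < P).
Local Notation nearest := (nearest a P).
Local Notation wave := (wave a P).

Definition bounded_measurable (g : R -> R) :=
  measurable_fun setT g /\ exists M, forall t, `|g t| <= M.

Lemma bounded_measurableB g h : bounded_measurable g -> bounded_measurable h ->
  bounded_measurable (fun t => g t - h t).
Proof.
move=> [mg [M gM]] [mh [N hN]]; split; first exact: measurable_funB.
by exists (M + N) => t; rewrite (le_trans (ler_normB _ _)) // lerD.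
Qed.

Lemma bounded_measurableM g h : bounded_measurable g -> bounded_measurable h ->
  bounded_measurable (fun t => g t * h t).
Proof.
move=> [mg [M gM]] [mh [N hN]]; split; first exact: measurable_funM.
by exists (M * N) => t; rewrite normrM ler_pM.
Qed.

Lemma bounded_measurableZ k g : bounded_measurable g ->
  bounded_measurable (fun t => k * g t).
Proof.
move=> bg; apply: (@bounded_measurableM (cst k)) => //.
by split=> //; exists `|k|.
Qed.

(* The weight makes every bounded function integrable over the line, and, being
   constant on each cell, keeps the harmonics orthogonal. *)
Definition wmean (g : R -> R) : R :=
  \int[mu]_t (weight (nearest t) * g t).

Lemma integrable_wmean g : bounded_measurable g ->
  mu.-integrable setT (EFin \o (fun t => weight (nearest t) * g t)).
Proof.
move=> [mg [M gM]]; apply: (integrable_le_weight P0 (a := a) (K := M)).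
  by apply: measurable_funM => //; exact: measurable_step.
move=> t; rewrite normrM mulrC (ger0_norm (weight_ge0 _)).
by apply: ler_wpM2r; [exact: weight_ge0|exact: gM].
Qed.

Lemma wmeanB g h : bounded_measurable g -> bounded_measurable h ->
  wmean (fun t => g t - h t) = wmean g - wmean h.
Proof.
move=> bg bh; rewrite /wmean -RintegralB //; last 2 first.
- exact: integrable_wmean.
- exact: integrable_wmean.
by apply: eq_Rintegral => t _; rewrite mulrBr.
Qed.

Lemma wmeanZ k g : bounded_measurable g ->
  wmean (fun t => k * g t) = k * wmean g.
Proof.
move=> bg; rewrite /wmean -RintegralZl //; last exact: integrable_wmean.
by apply: eq_Rintegral => t _; rewrite mulrCA.
Qed.

Lemma wmean1_gt0 : 0 < wmean (cst 1).
Proof.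
have w1 l : `|weight l| <= 1 * weight l :> R.
  by rewrite mul1r ger0_norm ?weight_ge0.
have -> : wmean (cst 1) = \int[mu]_t weight (nearest t).
  by apply: eq_Rintegral => t _; rewrite mulr1.
have cv := cvg_step_total (a := a) P0 w1.
(* The cell of index 0 has weight 1 and length [P], so it contributes [P] by itself. *)
apply: (lt_le_trans P0); rewrite -(cvg_lim (@Rhausdorff R) cv).
apply: limr_ge; first by apply/cvg_ex; eexists; exact: cv.
exists 1%N => // -[//|L] _; rewrite (ler_peMr (ltW P0)) // /symsum.
rewrite big_nat_recl // (_ : weight (Posz 0) = 1); last first.
  by rewrite /weight expr0n addr0 invr1.
by rewrite -addrA lerDl addr_ge0 // sumr_ge0 // => n _; exact: weight_ge0.
Qed.

Section OrthogonalFamily.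
Variables (f : nat -> R -> R) (A : R) (b : R -> R).
Hypotheses (bf : forall k, bounded_measurable (f k))
  (bb : bounded_measurable b) (A0 : 0 < A)
  (f_orth : forall j k, wmean (fun t => f j t * f k t) = A * (j == k)%:R).

Let coef k := wmean (fun t => b t * f k t).

(** This is [b] minus its orthogonal projection on the first [n] functions. Removing one function at
    a time leaves the later coefficients unchanged, so each step subtracts one square from the
    squared norm. *)
Fixpoint residual (n : nat) : R -> R :=
  if n is n'.+1 then fun t => residual n' t - A^-1 * coef n' * f n' t else b.

Lemma bounded_measurable_residual n : bounded_measurable (residual n).
Proof.
elim: n => [//|n IH] /=; apply: bounded_measurableB => //.
exact: bounded_measurableZ.
Qed.

Lemma wmean_residual n k : (n <= k)%N ->
  wmean (fun t => residual n t * f k t) = coef k.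
Proof.
elim: n => [//|n IH] nk /=.
have -> : (fun t => (residual n t - A^-1 * coef n * f n t) * f k t) =
  (fun t => residual n t * f k t - (A^-1 * coef n) * (f n t * f k t)).
  by apply/funext => t; ring.
have bfk := bounded_measurableM (bounded_measurable_residual n) (bf k).
have bff := bounded_measurableM (bf n) (bf k).
rewrite wmeanB ?wmeanZ ?IH ?f_orth ?(ltnW nk) //; last exact: bounded_measurableZ.
by rewrite ltn_eqF // !mulr0 subr0.
Qed.

Lemma wmean_residual_sqr n :
  wmean (fun t => residual n t * residual n t) =
  wmean (fun t => b t * b t) - A^-1 * \sum_(0 <= k < n) coef k ^+ 2.
Proof.
elim: n => [|n IH] /=; first by rewrite big_geq // mulr0 subr0.
set s := A^-1 * coef n; set r := residual n.
have -> : (fun t => (r t - s * f n t) * (r t - s * f n t)) =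
  (fun t => r t * r t - (2 * s * (r t * f n t) - s ^+ 2 * (f n t * f n t))).
  by apply/funext => t; ring.
have br := bounded_measurable_residual n.
have brr := bounded_measurableM br br.
have brf := bounded_measurableM br (bf n).
have bff := bounded_measurableM (bf n) (bf n).
have b1 := bounded_measurableZ (2 * s) brf.
have b2 := bounded_measurableZ (s ^+ 2) bff.
rewrite !wmeanB ?wmeanZ //; last exact: bounded_measurableB.
rewrite IH f_orth eqxx wmean_residual // big_nat_recr //= /s.
have A1 : A != 0 by rewrite gt_eqF.
by field.
Qed.

(** The squared norm of the residual is nonnegative, which bounds the sums of squared coefficients;
    a convergent series has terms tending to 0. *)
Lemma bessel_cvg0 : coef @ \oo --> 0.
Proof.
have le_sum n : \sum_(0 <= k < n) coef k ^+ 2 <= A * wmean (fun t => b t * b t).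
  rewrite -ler_pdivrMl // -subr_ge0 -wmean_residual_sqr.
  apply: Rintegral_ge0 => t _; rewrite mulr_ge0 ?weight_ge0 // -expr2.
  exact: sqr_ge0.
have cv : cvgn (series (fun k => coef k ^+ 2)).
  apply: nondecreasing_is_cvgn.
    by apply: nondecreasing_series => n _ _; exact: sqr_ge0.
  by exists (A * wmean (fun t => b t * b t)) => _ [n _ <-]; exact: le_sum.
have := cvg_series_cvg_0 cv => cv2.
apply/norm_cvg0P; apply/cvgrPdist_lt => e e0.
have e20 : 0 < e ^+ 2 by rewrite exprn_gt0.
move/cvgrPdist_lt : cv2 => /(_ _ e20); apply: filterS => k.
rewrite !sub0r !normrN normr_id normrX => h.
by rewrite -(ltr_pXn2r (n := 2)) // nnegrE // ltW.
Qed.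

End OrthogonalFamily.

End WeightedBessel.

(** * Convergence of the Fourier coefficients of a real function *)

Section PoissonReal.
Set Implicit Arguments.
Unset Strict Implicit.
Local Open Scope classical_set_scope.
Context {R : realType}.
Notation mu := (@lebesgue_measure R).
Variables (a P : R) (P0 : 0 < P).
Local Notation nearest := (nearest a P).
Local Notation node := (node a P).
Local Notation wave := (wave a P).

Lemma sin_prod (x y : R) : sin x * sin y = 2^-1 * (cos (x - y) - cos (x + y)).
Proof. by rewrite cosB cosD; field. Qed.

Lemma cos_prod (x y : R) : cos x * cos y = 2^-1 * (cos (x - y) + cos (x + y)).
Proof. by rewrite cosB cosD; field. Qed.

Lemma cos_waveB_odd j k t :
  cos (wave j.*2.+1 t - wave k.*2.+1 t) = cos (wave (`|j - k|%N).*2 t).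
Proof.
rewrite /wave -mulrBl; have [jk|/ltnW jk] := leqP j k.
  rewrite -cosN -mulNr opprB -natrB; last lia.
  by congr (cos (_%:R * _)); lia.
rewrite -natrB; last lia.
by congr (cos (_%:R * _)); lia.
Qed.

Lemma wmean_cos m :
  wmean a P (fun t => cos (wave m.*2 t)) = wmean a P (cst 1) * (m == 0%N)%:R.
Proof.
case: m => [|m] /=.
  rewrite mulr1; apply: eq_Rintegral => t _.
  by rewrite /wave mul0r cos0.
rewrite mulr0; apply: (Rintegral_step_cos a P0 (K := 1)) => // l.
by rewrite mul1r ger0_norm ?weight_ge0.
Qed.

Lemma bounded_measurable_cos j : bounded_measurable (fun t => cos (wave j t)).
Proof.
split; first exact: (continuous_measurable_fun (@continuous_cos_wave _ a P j)).
by exists 1 => t; exact: cos_max.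
Qed.

Lemma bounded_measurable_sin j : bounded_measurable (fun t => sin (wave j t)).
Proof.
split; first exact: (continuous_measurable_fun (@continuous_sin_wave _ a P j)).
by exists 1 => t; exact: sin_max.
Qed.

(** The difference and the sum of two odd indices are even, so the product is a combination of
    cosines of period [P]. The sum index is never 0, and the difference index is 0 only for [j = k],
    whence half the total weight. *)
Lemma wmean_sin_orth j k :
  wmean a P (fun t => sin (wave j.*2.+1 t) * sin (wave k.*2.+1 t)) =
  2^-1 * wmean a P (cst 1) * (j == k)%:R.
Proof.
have -> : (fun t => sin (wave j.*2.+1 t) * sin (wave k.*2.+1 t)) =
  (fun t => 2^-1 * (cos (wave (`|j - k|%N).*2 t) - cos (wave (j + k).+1.*2 t))).
  apply/funext => t; rewrite sin_prod cos_waveB_odd; congr (_ * (_ - cos _)).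
  by rewrite /wave -mulrDl -natrD; congr (_%:R * _); lia.
have b1 := bounded_measurable_cos (`|j - k|%N).*2.
have b2 := bounded_measurable_cos (j + k).+1.*2.
rewrite wmeanZ // ?wmeanB // ?wmean_cos /=; last exact: bounded_measurableB.
rewrite mulr0 subr0 mulrA; congr (_ * _%:R); congr nat_of_bool; lia.
Qed.

Lemma wmean_cos_orth j k :
  wmean a P (fun t => cos (wave j.*2.+1 t) * cos (wave k.*2.+1 t)) =
  2^-1 * wmean a P (cst 1) * (j == k)%:R.
Proof.
have -> : (fun t => cos (wave j.*2.+1 t) * cos (wave k.*2.+1 t)) =
  (fun t => 2^-1 * (cos (wave (`|j - k|%N).*2 t) -
                    -1 * cos (wave (j + k).+1.*2 t))).
  apply/funext => t; rewrite cos_prod cos_waveB_odd mulN1r opprK.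
  congr (_ * (_ + cos _)).
  by rewrite /wave -mulrDl -natrD; congr (_%:R * _); lia.
have b1 := bounded_measurable_cos (`|j - k|%N).*2.
have b2 := bounded_measurable_cos (j + k).+1.*2.
have b3 := bounded_measurableZ (-1) b2.
rewrite wmeanZ // ?wmeanB // ?wmeanZ // ?wmean_cos /=; last exact: bounded_measurableB.
by rewrite !mulr0 subr0 mulrA; congr (_ * _%:R); congr nat_of_bool; lia.
Qed.

(** From [0 <= cos (2 x) = 2 (cos x)^2 - 1] together with [(cos x)^2 <= cos x]. *)
Lemma cos_ge_half (x : R) : 0 <= x <= pi / 4 -> 2^-1 <= cos x.
Proof.
move=> /andP[x0 x4]; have pi0 := pi_gt0 R.
have c0 : 0 <= cos x by apply: cos_ge0_pihalf; lra.
have c1 := cos_le1 x.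
have : 0 <= cos (x *+ 2) by apply: cos_ge0_pihalf; rewrite [x *+ 2]mulr2n; lra.
by rewrite cos_mulr2n [_ *+ 2]mulr2n; nra.
Qed.

(** Write [sin x = 2 cos (x / 2) sin (x / 2)] and [sin (x / 2) = cos c * (x / 2)] by the mean value
    theorem; both cosines are at least 1/2. *)
Lemma sin_ge_quarter (x : R) : 0 <= x <= pi / 2 -> x / 4 <= sin x.
Proof.
move=> /andP[x0 x2].
have [c cx] : exists2 c, c \in `[0, x / 2]%R &
    sin (x / 2) - sin 0 = cos c * (x / 2 - 0).
  apply: (@MVT_segment R sin cos 0 (x / 2)); first lra.
  by apply: continuous_subspaceT; exact: continuous_sin.
rewrite sin0 !subr0 => e; move: cx; rewrite in_itv /= => /andP[c0 c1].
have h1 : 2^-1 <= cos c by apply: cos_ge_half; lra.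
have h2 : 2^-1 <= cos (x / 2) by apply: cos_ge_half; lra.
have -> : sin x = 2 * (cos (x / 2) * sin (x / 2)).
  by rewrite mulr_natl -sin_mulr2n -mulr_natl; congr sin; field.
have h3 : 2^-1 * 2^-1 <= cos (x / 2) * cos c by rewrite ler_pM.
rewrite e; nra.
Qed.

Lemma sin_pi_int (l : int) : sin (pi * l%:~R) = 0 :> R.
Proof.
have sinn n : sin (pi *+ n) = 0 :> R.
  by rewrite -[pi *+ n]add0r (alternatingn (@sinDpi R)) sin0 mulr0.
case: l => n; first by rewrite -pmulrn mulr_natr sinn.
by rewrite NegzE mulrNz mulrN sinN -pmulrn mulr_natr sinn oppr0.
Qed.

Lemma normr_sinD_pi_int (l : int) (x : R) : `|sin (pi * l%:~R + x)| = `|sin x|.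
Proof.
have s0 := sin_pi_int l.
by rewrite sinD s0 mul0r add0r normrM (sin0cos1 s0) mul1r.
Qed.

(** Modulo [pi], the angle is [pi d / P] with [|d| <= P / 2], where [sin_ge_quarter] applies;
    [pi >= 2] then gives the constant. The sine thus vanishes at the nodes to first order only. *)
Lemma wave1_sin_ge t :
  `|t - node (nearest t)| / (2 * P) <= `|sin (wave 1 t)|.
Proof.
set l := nearest t; set d := t - node l.
have /(nearest_bounds a P0) /andP[h1 h2] : nearest t = l by [].
have pi0 := pi_gt0 R; have pi2 := pi_ge2 R.
have -> : wave 1 t = pi * l%:~R + pi * (d / P).
  by rewrite /wave /phase mul1r -mulrDr; congr (_ * _); rewrite /d /node; field; rewrite gt_eqF.
rewrite normr_sinD_pi_int.
have dP : `|d| / P <= 2^-1.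
  by rewrite ler_pdivrMr // ler_norml; rewrite /d; lra.
have dP0 : 0 <= `|d| / P by rewrite divr_ge0 // ltW.
have -> : `|sin (pi * (d / P))| = `|sin (pi * (`|d| / P))|.
  have [d0|d0] := leP 0 d; first by rewrite (ger0_norm d0).
  by rewrite (ltr0_norm d0) mulNr mulrN sinN normrN.
apply: le_trans (ler_norm _).
have : pi * (`|d| / P) / 4 <= sin (pi * (`|d| / P)).
  by apply: sin_ge_quarter; nra.
by apply: le_trans; rewrite invfM mulrCA; nra.
Qed.

Variables (u : R -> R) (K : R).
Hypotheses (u_der : forall t, derivable u t 1)
  (u_le : forall t, `|u t| <= K * weight (nearest t))
  (du_le : forall t, `|u^`() t| <= K * weight (nearest t)).

Let sample (l : int) := u (node l).
Let step t := sample (nearest t).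
Let quot t := (u t - step t) / (2 * sin (wave 1 t)).

Let K_ge0 : 0 <= K.
Proof.
by rewrite -(pmulr_lge0 _ (weight_gt0 (nearest 0))) (le_trans _ (u_le 0)).
Qed.

Lemma sample_le l : `|sample l| <= K * weight l.
Proof. by have := u_le (node l); rewrite nearest_node. Qed.

Lemma continuous_u : continuous u.
Proof.
by move=> t; apply: differentiable_continuous; exact/derivable1_diffP.
Qed.

(** The mean value theorem between [t] and its node: the segment stays in one cell, on which the
    bound for the derivative is constant. *)
Lemma step_dist_le t : `|u t - step t| <=
  K * weight (nearest t) * `|t - node (nearest t)|.
Proof.
rewrite /step /sample; set l := nearest t; set c := node l.
have tl : nearest t = l by [].
have cl : nearest c = l by rewrite nearest_node.
have main (x y : R) : x <= y -> nearest x = l -> nearest y = l ->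
    `|u y - u x| <= K * weight l * `|y - x|.
  move=> xy /(nearest_bounds a P0) /andP[xl _] /(nearest_bounds a P0) /andP[_ yl].
  have du (z : R) : z \in `]x, y[%R -> is_derive z 1 u (u^`() z).
    by move=> _; rewrite derive1E; exact/derivableP.
  have [z zxy ->] := MVT_segment xy du (continuous_subspaceT continuous_u).
  rewrite normrM ler_wpM2r //; move: zxy; rewrite in_itv /= => /andP[xz zy].
  have <- : nearest z = l by apply/(nearest_bounds a P0); lra.
  exact: du_le.
have [tc|ct] := leP t c; last exact: main (ltW ct) cl tl.
by rewrite distrC [`|t - c|]distrC; exact: main.
Qed.

Lemma quotK t : quot t * (2 * sin (wave 1 t)) = u t - step t.
Proof.
rewrite /quot; have [s0|s0] := eqVneq (sin (wave 1 t)) 0; last first.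
  by rewrite divfK // mulf_neq0.
(* At a zero of the sine the quotient is 0 by the convention on division; the identity survives
   because such a [t] is a node, where [u] and [step] agree. *)
have : `|t - node (nearest t)| / (2 * P) <= 0.
  by have := wave1_sin_ge t; rewrite s0 normr0.
rewrite pmulr_lle0 ?invr_gt0 ?mulr_gt0 // normr_le0 => /eqP d0.
have := step_dist_le t; rewrite d0 normr0 mulr0 normr_le0 => /eqP ->.
by rewrite !mul0r.
Qed.

(** The distance to the node bounds the numerator from above and the sine from below, and
    cancels. *)
Lemma quot_le t : `|quot t| <= K * P * weight (nearest t).
Proof.
rewrite /quot; have [s0|s0] := eqVneq (sin (wave 1 t)) 0.
  by rewrite s0 mulr0 invr0 mulr0 normr0 !mulr_ge0 // ?ltW // weight_gt0.
have sp : 0 < `|2 * sin (wave 1 t)| by rewrite normr_gt0 mulf_neq0.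
rewrite normrM normfV ler_pdivrMr // (le_trans (step_dist_le t)) //.
have := wave1_sin_ge t; rewrite ler_pdivrMr ?mulr_gt0 // => h.
rewrite normrM [`|2|]ger0_norm //.
have -> : K * P * weight (nearest t) * (2 * `|sin (wave 1 t)|) =
  K * weight (nearest t) * (`|sin (wave 1 t)| * (2 * P)) by ring.
by rewrite ler_wpM2l // mulr_ge0 // weight_ge0.
Qed.

Lemma measurable_quot : measurable_fun setT quot.
Proof.
apply: measurable_funM.
  apply: measurable_funB; last exact: measurable_step.
  exact: continuous_measurable_fun continuous_u.
apply: measurableT_comp; first exact: measurable_inv.
apply: measurable_funM => //.
exact: (continuous_measurable_fun (@continuous_sin_wave _ a P 1)).
Qed.

Let integrable_quot f : bounded_measurable f -> (forall t, `|f t| <= 1) ->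
  mu.-integrable setT (EFin \o (fun t => quot t * f t)).
Proof.
move=> [mf _] f1; apply: (integrable_le_weight (K := K * P) P0 (a := a)).
  by apply: measurable_funM => //; exact: measurable_quot.
move=> t; rewrite normrM (le_trans _ (quot_le t)) // ler_piMr //.
Qed.

(** [bessel_cvg0] is applied to [quot] divided by the weight: this function is bounded, and its
    weighted coefficients are the plain integrals of [quot] against [f k]. *)
Lemma quot_cvg0 (f : nat -> R -> R) : (forall k, bounded_measurable (f k)) ->
  (forall j k, wmean a P (fun t => f j t * f k t) =
     2^-1 * wmean a P (cst 1) * (j == k)%:R) ->
  (fun k => \int[mu]_t (quot t * f k t)) @ \oo --> 0.
Proof.
move=> bf forth.
have A0 : 0 < 2^-1 * wmean a P (cst 1) by rewrite mulr_gt0 ?invr_gt0 ?wmean1_gt0.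
have bq : bounded_measurable (fun t => quot t * (weight (nearest t))^-1).
  split.
    apply: measurable_funM; first exact: measurable_quot.
    exact: (@measurable_step _ a P P0 (fun l => (weight l)^-1)).
  exists (K * P) => t; rewrite normrM normfV [`|weight _|]ger0_norm ?weight_ge0 //.
  by rewrite ler_pdivrMr ?weight_gt0 // quot_le.
have := bessel_cvg0 P0 bf bq A0 forth; apply: cvg_trans; apply: near_eq_cvg.
apply: nearW => k; apply: eq_Rintegral => t _.
by field; rewrite gt_eqF ?weight_gt0.
Qed.

Lemma bounded_measurable_le1 (f : R -> R) : measurable_fun setT f ->
  (forall t, `|f t| <= 1) -> bounded_measurable f.
Proof. by move=> mf f1; split => //; exists 1. Qed.

Lemma integrable_mul (f : R -> R) : measurable_fun setT f ->
  (forall t, `|f t| <= 1) -> mu.-integrable setT (EFin \o (fun t => u t * f t)).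
Proof.
move=> mf f1; apply: (integrable_le_weight (K := K) P0 (a := a)).
  apply: measurable_funM => //; exact: continuous_measurable_fun continuous_u.
by move=> t; rewrite normrM (le_trans _ (u_le t)) // ler_piMr.
Qed.

(* Twice the sine turns the (2n+2)-nd harmonic into a difference of two
   consecutive odd harmonics, so that the series of coefficients telescopes. *)
Lemma Rintegral_telescope (f : R -> R) (h : nat -> R -> R) n :
  measurable_fun setT f -> (forall t, `|f t| <= 1) ->
  (forall k, measurable_fun setT (h k)) -> (forall k t, `|h k t| <= 1) ->
  (forall t, 2 * sin (wave 1 t) * f t = h n.+1 t - h n t) ->
  \int[mu]_t (step t * f t) = 0 ->
  \int[mu]_t (u t * f t) =
    \int[mu]_t (quot t * h n.+1 t) - \int[mu]_t (quot t * h n t).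
Proof.
move=> mf f1 mh h1 fh sf0.
have ih k := integrable_quot (bounded_measurable_le1 (mh k) (h1 k)) (h1 k).
have sfi := integrable_step a P0 sample_le mf f1.
(* Subtracting the vanishing coefficient of [step] replaces [u] by [u - step], which factors through
   [quot]. *)
rewrite -[LHS]subr0 -sf0 -!RintegralB //; last first.
  exact: integrable_mul.
apply: eq_Rintegral => t _.
by rewrite -mulrBl -quotK -mulrA fh mulrBr.
Qed.

Let bms j := bounded_measurable_sin j.
Let bmc j := bounded_measurable_cos j.

Lemma sin_prod_telescope n t : 2 * sin (wave 1 t) * cos (wave n.+1.*2 t) =
  sin (wave n.+1.*2.+1 t) - sin (wave n.*2.+1 t).
Proof.
have -> : wave n.+1.*2.+1 t = wave n.+1.*2 t + wave 1 t.
  by rewrite /wave -mulrDl -natrD addn1.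
have -> : wave n.*2.+1 t = wave n.+1.*2 t - wave 1 t.
  by rewrite /wave -mulrBl -natrB // doubleS subn1.
by rewrite sinD sinB; ring.
Qed.

Lemma cos_prod_telescope n t : 2 * sin (wave 1 t) * sin (wave n.+1.*2 t) =
  (- cos (wave n.+1.*2.+1 t)) - (- cos (wave n.*2.+1 t)).
Proof.
have -> : wave n.+1.*2.+1 t = wave n.+1.*2 t + wave 1 t.
  by rewrite /wave -mulrDl -natrD addn1.
have -> : wave n.*2.+1 t = wave n.+1.*2 t - wave 1 t.
  by rewrite /wave -mulrBl -natrB // doubleS subn1.
by rewrite cosD cosB; ring.
Qed.

(** The telescoping series leaves minus its initial term, the integral of [quot] against the sine of
    [wave 1]. Since [quot] times twice that sine is [u - step], this is where the sum of samples
    enters. *)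
Lemma cvg_cos_coefficients :
  series (fun n => \int[mu]_t (u t * cos (wave n.+1.*2 t))) @ \oo -->
  2^-1 * (\int[mu]_t step t - \int[mu]_t u t).
Proof.
pose A k := \int[mu]_t (quot t * sin (wave k.*2.+1 t)).
have A0 : 2 * A 0%N = \int[mu]_t u t - \int[mu]_t step t.
  have m1 : measurable_fun setT (cst 1 : R -> R) by [].
  have n1 (t : R) : `|(1 : R)| <= 1 by rewrite normr1.
  have iu := integrable_mul m1 n1; have ist := integrable_step a P0 sample_le m1 n1.
  rewrite -RintegralB //; last 2 first.
  - by move: iu; under eq_fun do rewrite mulr1.
  - by move: ist; under eq_fun do rewrite mulr1.
  rewrite /A -RintegralZl //; last first.
    by apply: integrable_quot => // t; exact: sin_max.
  by apply: eq_Rintegral => t _; rewrite -quotK mulrCA.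
have -> : (fun n => \int[mu]_t (u t * cos (wave n.+1.*2 t))) = telescope A.
  apply/funext => n; apply: (@Rintegral_telescope _ (fun k t => sin (wave k.*2.+1 t))).
  - exact: (bmc _).1.
  - by move=> t; exact: cos_max.
  - by move=> k; exact: (bms _).1.
  - by move=> k t; exact: sin_max.
  - exact: sin_prod_telescope.
  - exact: (Rintegral_step_cos a P0 sample_le).
rewrite telescopeK.
have -> : 2^-1 * (\int[mu]_t step t - \int[mu]_t u t) = 0 - A 0%N.
  by apply: (@mulfI _ 2) => //; rewrite mulVKf // sub0r mulrN A0 opprB.
apply: cvgB; last exact: cvg_cst.
by apply: quot_cvg0 => [k|j k]; [exact: bms|exact: wmean_sin_orth].
Qed.

(** The limit stays anonymous: the two halves of the bilateral series carry it with opposite signs.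
    Its existence is what lets each half converge separately. *)
Lemma cvg_sin_coefficients : exists B : R,
  series (fun n => \int[mu]_t (u t * sin (wave n.+1.*2 t))) @ \oo --> B.
Proof.
pose A k := \int[mu]_t (quot t * - cos (wave k.*2.+1 t)).
have bmcN k : bounded_measurable (fun t => - cos (wave k t)).
  have := bounded_measurableZ (-1) (bmc k).
  by under eq_fun do rewrite mulN1r.
exists (0 - A 0%N).
have -> : (fun n => \int[mu]_t (u t * sin (wave n.+1.*2 t))) = telescope A.
  apply/funext => n; apply: (@Rintegral_telescope _ (fun k t => - cos (wave k.*2.+1 t))).
  - exact: (bms _).1.
  - by move=> t; exact: sin_max.
  - by move=> k; exact: (bmcN _).1.
  - by move=> k t; rewrite normrN; exact: cos_max.
  - exact: cos_prod_telescope.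
  - exact: (Rintegral_step_sin a P0 sample_le).
rewrite telescopeK.
apply: cvgB; last exact: cvg_cst.
apply: quot_cvg0 => [k|j k]; first exact: bmcN.
rewrite -wmean_cos_orth; apply: eq_Rintegral => t _.
by rewrite mulrNN.
Qed.

Lemma cvg_symsum_samples :
  (fun L => P * symsum (fun l => u (node l)) L) @ \oo --> \int[mu]_t step t.
Proof. exact: (cvg_step_total P0 sample_le). Qed.

End PoissonReal.

(** * Bilateral complex series and their symmetric sums *)

Section ComplexSequences.
Set Implicit Arguments.
Unset Strict Implicit.
Local Open Scope classical_set_scope.
Context {R : realType}.
Local Notation Re := (@complex.Re R).
Local Notation Im := (@complex.Im R).
Implicit Types (z w : nat -> R[i]) (a : int -> R[i]) (l m : R[i]).

Definition ccvg z l : Prop :=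
  ((fun n => Re (z n)) @ \oo --> Re l) /\ ((fun n => Im (z n)) @ \oo --> Im l).

Lemma ReD l m : Re (l + m) = Re l + Re m. Proof. by case: l; case: m. Qed.
Lemma ImD l m : Im (l + m) = Im l + Im m. Proof. by case: l; case: m. Qed.
Lemma ReM l m : Re (l * m) = Re l * Re m - Im l * Im m.
Proof. by case: l; case: m. Qed.
Lemma ImM l m : Im (l * m) = Re l * Im m + Im l * Re m.
Proof. by case: l; case: m. Qed.

Lemma Re_sum I (r : seq I) (F : I -> R[i]) :
  Re (\sum_(i <- r) F i) = \sum_(i <- r) Re (F i).
Proof. exact: (big_morph Re ReD (erefl _)). Qed.

Lemma Im_sum I (r : seq I) (F : I -> R[i]) :
  Im (\sum_(i <- r) F i) = \sum_(i <- r) Im (F i).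
Proof. exact: (big_morph Im ImD (erefl _)). Qed.

Lemma complex_inj l m : Re l = Re m -> Im l = Im m -> l = m.
Proof. by case: l => ? ?; case: m => ? ? /= -> ->. Qed.

Lemma ccvgD z w l m : ccvg z l -> ccvg w m ->
  ccvg (fun n => z n + w n) (l + m).
Proof.
move=> [z1 z2] [w1 w2]; split.
  by rewrite ReD; under eq_fun do rewrite ReD; exact: cvgD.
by rewrite ImD; under eq_fun do rewrite ImD; exact: cvgD.
Qed.

Lemma ccvgZ (c : R[i]) z l : ccvg z l -> ccvg (fun n => c * z n) (c * l).
Proof.
move=> [z1 z2]; split.
  rewrite ReM; under eq_fun do rewrite ReM.
  by apply: cvgB; apply: cvgMr.
rewrite ImM; under eq_fun do rewrite ImM.
by apply: cvgD; apply: cvgMr.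
Qed.

Lemma ccvg_cst l : ccvg (fun=> l) l.
Proof. by split; exact: cvg_cst. Qed.

Lemma ccvg_sum I (r : seq I) (z : I -> nat -> R[i]) (l : I -> R[i]) :
  (forall i, ccvg (z i) (l i)) ->
  ccvg (fun n => \sum_(i <- r) z i n) (\sum_(i <- r) l i).
Proof.
move=> zl; elim: r => [|i r IH].
  by rewrite big_nil; under eq_fun do rewrite big_nil; exact: ccvg_cst.
rewrite big_cons; under eq_fun do rewrite big_cons.
exact: ccvgD.
Qed.

Lemma ccvg_unique z l m : ccvg z l -> ccvg z m -> l = m.
Proof.
move=> [z1 z2] [w1 w2]; apply: complex_inj.
  exact: cvg_unique z1 w1.
exact: cvg_unique z2 w2.
Qed.

Lemma ccvg_comp z l (s : nat -> nat) : s @ \oo --> \oo -> ccvg z l ->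
  ccvg (z \o s) l.
Proof.
move=> so [z1 z2]; split.
  exact: (cvg_comp s _ so z1).
exact: (cvg_comp s _ so z2).
Qed.

Lemma ccvg_series_shift z l : ccvg (series (fun n => z n.+1)) l ->
  ccvg (series z) (z 0%N + l).
Proof.
move=> zl; have [h1 h2] := ccvgD (ccvg_cst (z 0%N)) zl.
have e n : z 0%N + series (fun n => z n.+1) n = series z n.+1.
  by rewrite /series /= big_nat_recl.
by split; rewrite -(cvg_shiftS _); [move: h1|move: h2]; under eq_fun do rewrite e.
Qed.

(** Keeping the limits of both halves in a relation lets bilateral series be added and scaled
    without separate convergence conditions, which the total [sumZ] would demand. *)
Definition sumZ_halves a l m : Prop :=
  ccvg (series (fun n => a (Posz n))) l /\ ccvg (series (fun n => a (Negz n))) m.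

Lemma Re_series z n : Re (series z n) = series (fun n => Re (z n)) n.
Proof. exact: Re_sum. Qed.

Lemma Im_series z n : Im (series z n) = series (fun n => Im (z n)) n.
Proof. exact: Im_sum. Qed.

Lemma sumZ_halvesP a l m : sumZ_halves a l m -> Defs.cvgZ a /\ sumZ a = l + m.
Proof.
move=> [[p1 p2] [n1 n2]].
have e1 z : (fun n => Re (series z n)) = series (fun n => Re (z n)).
  by apply/funext => n; exact: Re_series.
have e2 z : (fun n => Im (series z n)) = series (fun n => Im (z n)).
  by apply/funext => n; exact: Im_series.
rewrite !e1 in p1 n1; rewrite !e2 in p2 n2; split.
  by split; split; apply/cvg_ex; eexists; eassumption.
apply: complex_inj; rewrite /sumZ /sumZ_real /= ?ReD ?ImD.
  by rewrite (cvg_lim _ p1) // (cvg_lim _ n1).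
by rewrite (cvg_lim _ p2) // (cvg_lim _ n2).
Qed.

Lemma sumZ_halvesZ (c : R[i]) a l m : sumZ_halves a l m ->
  sumZ_halves (fun k => c * a k) (c * l) (c * m).
Proof.
have e z : series (fun n => c * z n) = (fun n => c * series z n).
  by apply/funext => n; rewrite /series /= mulr_sumr.
by move=> [p n]; split; rewrite e; exact: ccvgZ.
Qed.

Lemma sumZ_halvesD a b l m l' m' : sumZ_halves a l m -> sumZ_halves b l' m' ->
  sumZ_halves (fun k => a k + b k) (l + l') (m + m').
Proof.
have e z w : series (fun n => z n + w n) = (fun n => series z n + series w n).
  by apply/funext => n; rewrite /series /= big_split.
by move=> [p n] [p' n']; split; rewrite e; exact: ccvgD.
Qed.

Lemma sumZ_halves_sum (I : Type) (r : seq I) (a : I -> int -> R[i])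
    (l m : I -> R[i]) :
  (forall i, sumZ_halves (a i) (l i) (m i)) ->
  sumZ_halves (fun k => \sum_(i <- r) a i k) (\sum_(i <- r) l i) (\sum_(i <- r) m i).
Proof.
move=> alm.
have e (z : I -> nat -> R[i]) : series (fun n => \sum_(i <- r) z i n) =
    (fun n => \sum_(i <- r) series (z i) n).
  by apply/funext => n; rewrite /series /= exchange_big.
by split; rewrite e; apply: ccvg_sum => i; have [] := alm i.
Qed.

Lemma ccvg_symsum a l m : sumZ_halves a l m -> ccvg (symsum a) (l + m).
Proof. by move=> [p n]; exact: ccvgD p n. Qed.

(** Each integer of [[- L N, L N)] is uniquely [i + k N] with [0 <= i < N] and [- L <= k < L]. *)
Lemma symsum_blocks (V : zmodType) (F : int -> V) (N L : nat) :
  symsum F (L * N) = \sum_(i < N) symsum (fun k => F (i%:Z + k * N%:Z)) L.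
Proof.
elim: L => [|L IH].
  rewrite mul0n /symsum !big_geq // addr0 big1 // => i _.
  by rewrite !big_geq // addr0.
under eq_bigr do rewrite symsumS; rewrite big_split /= -IH big_split /=.
have cat (f : nat -> V) : \sum_(0 <= n < L * N + N) f n =
    \sum_(0 <= n < L * N) f n + \sum_(i < N) f (L * N + i)%N.
  rewrite (big_cat_nat (n := L * N)) ?leq_addr //=; congr (_ + _).
  rewrite -{1}(add0n (L * N)%N) big_addn addKn big_mkord.
  by apply: eq_bigr => i _; rewrite addnC.
rewrite mulSnr /symsum !cat addrACA; congr (_ + (_ + _)).
  by apply: eq_bigr => i _; congr F; lia.
(* Residues decrease along the negative half: [Negz (L * N + j)] has residue [N - 1 - j]. *)
rewrite (reindex_inj rev_ord_inj) /=; apply: eq_bigr => i _; congr F.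
have := ltn_ord i; lia.
Qed.

End ComplexSequences.

(** * Poisson summation for a complex Schwartz function *)

Section PoissonSchwartz.
Set Implicit Arguments.
Unset Strict Implicit.
Local Open Scope classical_set_scope.
Context {R : realType}.
Local Notation Re := (@complex.Re R).
Local Notation Im := (@complex.Im R).
Notation mu := (@lebesgue_measure R).
Implicit Types (phi : R -> R[i]).

Lemma normc_Re (z : R[i]) : `|Re z| <= Normc.normc z.
Proof.
by case: z => x y /=; rewrite -sqrtr_sqr ler_wsqrtr // lerDl sqr_ge0.
Qed.

Lemma normc_Im (z : R[i]) : `|Im z| <= Normc.normc z.
Proof.
by case: z => x y /=; rewrite -sqrtr_sqr ler_wsqrtr // lerDr sqr_ge0.
Qed.

Lemma normc_ge0 (z : R[i]) : 0 <= Normc.normc z.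
Proof. exact: le_trans (normr_ge0 _) (normc_Re z). Qed.

Lemma normc_le_ReIm (z : R[i]) : Normc.normc z <= `|Re z| + `|Im z|.
Proof.
case: z => x y /=; rewrite -(ler_pXn2r (n := 2)) ?nnegrE ?sqrtr_ge0 ?addr_ge0 //.
rewrite sqr_sqrtr ?addr_ge0 ?sqr_ge0 // sqrrD !real_normK ?num_real //.
by rewrite lerD2r lerDl mulrn_wge0 // mulr_ge0.
Qed.

Lemma le_seminorm p q phi t : schwartz phi ->
  `|t| ^+ p * Normc.normc (cderiv q phi t) <= seminorm p q phi.
Proof.
move=> [_ /(_ p q) ub]; apply: ub_le_sup => //; by exists t.
Qed.

Lemma seminorm_ge0 p q phi : schwartz phi -> 0 <= seminorm p q phi.
Proof.
move=> /(le_seminorm p q 0); apply: le_trans.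
by rewrite mulr_ge0 ?exprn_ge0 ?normc_ge0.
Qed.

Lemma schwartz_decay q phi t : schwartz phi ->
  Normc.normc (cderiv q phi t) <=
  (seminorm 0 q phi + seminorm 2 q phi) * (oneDsqr t)^-1.
Proof.
move=> sphi; have T0 : 0 < oneDsqr t by rewrite (lt_le_trans ltr01) // oneDsqr_ge1.
rewrite ler_pdivlMr // /oneDsqr mulrDr mulr1 lerD //.
  by have := le_seminorm 0 q t sphi; rewrite expr0 mul1r.
by have := le_seminorm 2 q t sphi; rewrite real_normK ?num_real // mulrC.
Qed.

Lemma cderiv0 phi t : cderiv 0 phi t = phi t.
Proof. by rewrite /cderiv !derive1n0 /=; case: (phi t). Qed.

Lemma schwartz_weight (a P : R) phi : 0 < P -> schwartz phi ->
  exists K, forall t, Normc.normc (phi t) <= K * weight (nearest a P t) /\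
                      Normc.normc (cderiv 1 phi t) <= K * weight (nearest a P t).
Proof.
move=> P0 sphi; set D := 2 + 3 * P^-1 ^+ 2 * (1 + a ^+ 2).
have D0 : 0 <= D by rewrite /D; have := sqr_ge0 P^-1; have := sqr_ge0 a; nra.
pose S q := seminorm 0 q phi + seminorm 2 q phi.
have S0 q : 0 <= S q by rewrite addr_ge0 // seminorm_ge0.
exists ((S 0%N + S 1%N) * D) => t.
have w0 := weight_ge0 (R := R) (nearest a P t).
have main q : q \in [:: 0%N; 1%N] ->
    Normc.normc (cderiv q phi t) <= (S 0%N + S 1%N) * D * weight (nearest a P t).
  move=> qin; rewrite (le_trans (schwartz_decay q t sphi)) //.
  rewrite (le_trans (ler_wpM2l (S0 q) (oneDsqrV_le a P0 t))) // -[leRHS]mulrA -/D.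
  rewrite ler_wpM2r ?mulr_ge0 //.
  by move: qin; rewrite !inE => /orP[] /eqP ->; rewrite ?lerDl ?lerDr.
by rewrite -[phi t]cderiv0; split; exact: main.
Qed.

Variables (a P : R) (P0 : 0 < P) (phi : R -> R[i]) (sphi : schwartz phi).
Local Notation wave := (wave a P).
Local Notation node := (node a P).
Local Notation phase := (phase a P).

Let u := Re \o phi.
Let v := Im \o phi.

(** This is [P] times the [k]-th Fourier coefficient of the [P]-periodization of [phi], with phases
    counted from [a], written as an integral over the line. *)
Definition fcoef (k : int) : R[i] :=
  cintegral (fun t => phi t * expi (- (2 * pi * k%:~R * phase t))).

Lemma parts_weight : exists K,
  [/\ forall t, derivable u t 1,
      forall t, `|u t| <= K * weight (nearest a P t) &
      forall t, `|u^`() t| <= K * weight (nearest a P t)] /\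
  [/\ forall t, derivable v t 1,
      forall t, `|v t| <= K * weight (nearest a P t) &
      forall t, `|v^`() t| <= K * weight (nearest a P t)].
Proof.
have [K HK] := schwartz_weight a P0 sphi; have [sm _] := sphi; exists K.
split; split => t.
- by have [] := sm 0%N t.
- by apply: le_trans (normc_Re _) _; have [] := HK t.
- by apply: le_trans (normc_Re (cderiv 1 phi t)) _; have [] := HK t.
- by have [] := sm 0%N t.
- by apply: le_trans (normc_Im _) _; have [] := HK t.
- by apply: le_trans (normc_Im (cderiv 1 phi t)) _; have [] := HK t.
Qed.

Let Cu n := \int[mu]_t (u t * cos (wave n.*2 t)).
Let Su n := \int[mu]_t (u t * sin (wave n.*2 t)).
Let Cv n := \int[mu]_t (v t * cos (wave n.*2 t)).
Let Sv n := \int[mu]_t (v t * sin (wave n.*2 t)).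

Lemma wave_angle (n : nat) t : 2 * pi * (n : int)%:~R * phase t = wave n.*2 t.
Proof. by rewrite /wave -muln2 natrM -pmulrn; ring. Qed.

Lemma integrable_parts (f : R -> R) : measurable_fun setT f -> (forall t, `|f t| <= 1) ->
  mu.-integrable setT (EFin \o (fun t => u t * f t)) /\
  mu.-integrable setT (EFin \o (fun t => v t * f t)).
Proof.
have [K [[du uK _] [dv vK _]]] := parts_weight => mf f1; split.
  exact: (integrable_mul P0 du uK).
exact: (integrable_mul P0 dv vK).
Qed.

Let icos n := integrable_parts (bounded_measurable_cos a P n.*2).1
  (fun t => cos_max (wave n.*2 t)).
Let isin n := integrable_parts (bounded_measurable_sin a P n.*2).1
  (fun t => sin_max (wave n.*2 t)).

Lemma fcoef_Posz n : fcoef (Posz n) = (Cu n + Sv n) +i* (Cv n - Su n).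
Proof.
rewrite /fcoef /cintegral; congr (_ +i* _).
  rewrite -RintegralD //; [|exact: (icos _).1|exact: (isin _).2].
  apply: eq_Rintegral => t _; rewrite /= ReM /= wave_angle cosN sinN.
  by rewrite mulrN opprK.
rewrite -RintegralB //; [|exact: (icos _).2|exact: (isin _).1].
apply: eq_Rintegral => t _; rewrite /= ImM /= wave_angle cosN sinN.
by rewrite mulrN addrC.
Qed.

Lemma fcoef_Negz n : fcoef (Negz n) = (Cu n.+1 - Sv n.+1) +i* (Cv n.+1 + Su n.+1).
Proof.
have e t : - (2 * pi * (Negz n)%:~R * phase t) = wave n.+1.*2 t.
  by rewrite NegzE mulrNz mulrN mulNr opprK wave_angle.
rewrite /fcoef /cintegral; congr (_ +i* _).
  rewrite -RintegralB //; [|exact: (icos _).1|exact: (isin _).2].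
  by apply: eq_Rintegral => t _; rewrite /= ReM /= e.
rewrite -RintegralD //; [|exact: (icos _).2|exact: (isin _).1].
by apply: eq_Rintegral => t _; rewrite /= ImM /= e addrC.
Qed.

Lemma poisson_summation : exists l m : R[i],
  sumZ_halves fcoef l m /\
  ccvg (fun L => P%:C * symsum (phi \o node) L) (l + m).
Proof.
have [K [[du uK duK] [dv vK dvK]]] := parts_weight.
have cu := cvg_cos_coefficients P0 du uK duK.
have cv := cvg_cos_coefficients P0 dv vK dvK.
have [Bu su] := cvg_sin_coefficients P0 du uK duK.
have [Bv sv] := cvg_sin_coefficients P0 dv vK dvK.
have lu := cvg_symsum_samples P0 uK; have lv := cvg_symsum_samples P0 vK.
move: cu cv lu lv.
set Du := \int[mu]_t _; set Iu := \int[mu]_t u t => cu.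
set Dv := \int[mu]_t _; set Iv := \int[mu]_t v t => cv lu lv.
have w0 t : wave 0.*2 t = 0 by rewrite /wave mul0r.
have c0 (g : R -> R) : \int[mu]_t (g t * cos (wave 0.*2 t)) = \int[mu]_t g t.
  by apply: eq_Rintegral => t _; rewrite w0 cos0 mulr1.
have s0 (g : R -> R) : \int[mu]_t (g t * sin (wave 0.*2 t)) = 0.
  rewrite (@eq_Rintegral _ _ _ mu _ (fun=> 0)); last first.
    by move=> t _; rewrite w0 sin0 mulr0.
  by rewrite Rintegral_cst // mul0r.
have f0 : fcoef 0 = Iu +i* Iv.
  by rewrite fcoef_Posz /Cu /Sv /Cv /Su !c0 !s0 addr0 subr0.
(* The limits over positive and negative frequencies. In their sum [Bu] and [Bv] cancel and
   [Du - Iu], [Dv - Iv] remain; the term of index 0 restores [Iu] and [Iv], leaving the integrals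
   [Du], [Dv] of the step functions. *)
pose l' := (2^-1 * (Du - Iu) + Bv) +i* (2^-1 * (Dv - Iv) - Bu).
pose m := (2^-1 * (Du - Iu) - Bv) +i* (2^-1 * (Dv - Iv) + Bu).
have ccvg_pair (z : nat -> R[i]) (f g : nat -> R) (x y : R) :
    (forall n, z n = f n +i* g n) -> series f @ \oo --> x ->
    series g @ \oo --> y -> ccvg (series z) (x +i* y).
  move=> zE fx gy; split => /=.
    have -> // : (fun n => Re (series z n)) = series f.
    apply/funext => n; rewrite Re_series; apply: eq_bigr => k _.
    by rewrite zE.
  have -> // : (fun n => Im (series z n)) = series g.
  apply/funext => n; rewrite Im_series; apply: eq_bigr => k _.
  by rewrite zE.
have sD (f g : nat -> R) x y : series f @ \oo --> x -> series g @ \oo --> y ->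
    series (fun n => f n + g n) @ \oo --> x + y.
  move=> fx gy; have -> : series (fun n => f n + g n) = series f \+ series g.
    by apply/funext => n; rewrite /series /= big_split.
  exact: cvgD.
have sB (f g : nat -> R) x y : series f @ \oo --> x -> series g @ \oo --> y ->
    series (fun n => f n - g n) @ \oo --> x - y.
  move=> fx gy; have -> : series (fun n => f n - g n) = series f \- series g.
    by apply/funext => n; rewrite /series /= sumrB.
  exact: cvgB.
exists (fcoef 0 + l'), m; split; first split.
- apply: ccvg_series_shift.
  by apply: ccvg_pair (fun n => fcoef_Posz n.+1) _ _; [exact: sD cu sv|exact: sB cv su].
- by apply: ccvg_pair fcoef_Negz _ _; [exact: sB cu sv|exact: sD cv su].
have -> : fcoef 0 + l' + m = Du +i* Dv.
  by rewrite f0; apply: complex_inj; rewrite !(ReD, ImD) /=; field.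
split => /=.
  apply: cvg_trans lu; apply: near_eq_cvg; apply: nearW => L.
  by rewrite ReM /= mul0r subr0 /symsum ReD !Re_sum.
apply: cvg_trans lv; apply: near_eq_cvg; apply: nearW => L.
by rewrite ImM /= mul0r addr0 /symsum ImD !Im_sum.
Qed.

End PoissonSchwartz.

(** * Roots of unity and inversion of the DFT *)

Section DiscreteFourier.
Set Implicit Arguments.
Unset Strict Implicit.
Context {R : realType}.
Notation mu := (@lebesgue_measure R).

Lemma expiD (x y : R) : expi (x + y) = expi x * expi y.
Proof.
rewrite /expi cosD sinD; apply: complex_inj; rewrite ?(ReM, ImM) //=.
by rewrite addrC.
Qed.

Lemma expi0 : expi (0 : R) = 1.
Proof. by rewrite /expi cos0 sin0. Qed.

Lemma expiMn (x : R) n : expi (x *+ n) = expi x ^+ n.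
Proof.
by elim: n => [|n IH]; rewrite ?expi0 ?expr0 // mulrS expiD IH exprS.
Qed.

Lemma expi_2pi_int (k : int) : expi (2 * pi * k%:~R) = 1 :> R[i].
Proof.
have s0 := sin_pi_int (R := R) k.
have -> : 2 * pi * k%:~R = (pi * k%:~R) *+ 2 :> R by ring.
rewrite /expi sin_mulr2n cos_mulr2n s0 mulr0 mul0rn cos2sin2 s0 expr0n /=.
by congr (_ +i* _); ring.
Qed.

(** The half-angle formula turns a real part equal to 1 into [sin (pi x) = 0], impossible for
    [0 < |x| < 1]. *)
Lemma expi_neq1 (r : int) (N : nat) : r != 0 -> (`|r| < N)%N ->
  expi (2 * pi * (r%:~R / N%:R)) != 1 :> R[i].
Proof.
move=> r0 rN; have N0 : (0 < N)%N by exact: leq_ltn_trans rN.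
have NR : (0 : R) < N%:R by rewrite ltr0n.
set x : R := r%:~R / N%:R.
have x0 : x != 0 by rewrite mulf_neq0 ?intr_eq0 // invr_neq0 // gt_eqF.
have x1 : `|x| < 1.
  rewrite normrM normfV (ger0_norm (ltW NR)) ltr_pdivrMr // mul1r.
  by rewrite -intr_norm -abszE -pmulrn ltr_nat.
have -> : 2 * pi * x = (pi * x) *+ 2 by ring.
apply/eqP => /(congr1 (@complex.Re R)) /=; rewrite cos_mulr2n cos2sin2 => h.
have /eqP : sin (pi * x) ^+ 2 = 0 by lra.
have -> : pi * x = Num.sg x * (pi * `|x|) by rewrite [RHS]mulrCA -numEsg.
rewrite sqrf_eq0 sin_sg mulf_eq0 sgr_eq0 (negPf x0) /=.
apply/negP; rewrite gt_eqF // sin_gt0_pi // mulr_gt0 ?pi_gt0 ?normr_gt0 //=.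
by rewrite -[ltRHS]mulr1 ltr_pM2l ?pi_gt0.
Qed.

Lemma sum_roots_of_unity (N : nat) (r : int) : (`|r| < N)%N ->
  \sum_(m < N) expi (2 * pi * (r%:~R / N%:R)) ^+ m = (N * (r == 0))%:R :> R[i].
Proof.
move=> rN; have N0 : (0 < N)%N by exact: leq_ltn_trans rN.
have [->|r0] := eqVneq r 0.
  rewrite mul0r mulr0 expi0 muln1 -[RHS]mulr_natr mul1r.
  by rewrite (eq_bigr (fun=> 1)) => [|i _]; rewrite ?expr1n // sumr_const card_ord.
rewrite muln0; set z := expi _; have z1 : z != 1 by exact: expi_neq1.
have zN : z ^+ N = 1.
  rewrite /z -expiMn (_ : _ *+ N = 2 * pi * r%:~R) ?expi_2pi_int //.
  by rewrite -[_ *+ N]mulr_natr; field; rewrite pnatr_eq0 -lt0n.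
have := subrX1 z N; rewrite zN subrr => /esym/eqP.
by rewrite mulf_eq0 subr_eq0 (negPf z1) => /eqP.
Qed.

Lemma expi_modZ (N : nat) (hN : (0 < N)%N) (k : int) (m : nat) :
  expi (2 * pi * (k%:~R * m%:R / N%:R)) =
  expi (2 * pi * ((modZ hN k)%:R / N%:R)) ^+ m :> R[i].
Proof.
have NR : (N%:R : R) != 0 by rewrite pnatr_eq0 -lt0n.
have kE : (k%:~R : R) = (k %/ N)%Z%:~R * N%:R + (modZ hN k)%:R.
  rewrite {1}(divz_eq k N) intrD intrM -pmulrn; congr (_ + _).
  rewrite /modZ /= [RHS]pmulrn gez0_abs // modz_ge0 //.
  by rewrite eqz_nat -lt0n.
rewrite -expiMn (_ : 2 * pi * (k%:~R * m%:R / N%:R) =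
    2 * pi * ((k %/ N)%Z * m%:Z)%:~R + (2 * pi * ((modZ hN k)%:R / N%:R)) *+ m).
  by rewrite expiD expi_2pi_int mul1r.
by rewrite kE; field.
Qed.

(** By orthogonality of the characters modulo [N]. It holds at every integer [k], and so writes an
    [N]-periodic sequence as a finite combination of exponentials in [k]. *)
Lemma dft_inversion (N : nat) (hN : (0 < N)%N) (w : 'rV[R[i]]_N) (k : int) :
  \sum_(m < N) dft w 0 m * expi (2 * pi * (k%:~R * m%:R / N%:R)) =
  w 0 (modZ hN k).
Proof.
have NR : (N%:R : R) != 0 by rewrite pnatr_eq0 -lt0n.
have NC : (N%:R : R[i]) != 0 by rewrite pnatr_eq0 -lt0n.
set j := modZ hN k.
transitivity (N%:R^-1 * \sum_(n < N) w 0 n *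
    \sum_(m < N) expi (2 * pi * ((j%:Z - n%:Z)%:~R / N%:R)) ^+ m : R[i]).
  rewrite (eq_bigr (fun m : 'I_N => N%:R^-1 *
    (\sum_(n < N) expi (- (2 * pi * (m%:R * n%:R) / N%:R)) * w 0 n *
       expi (2 * pi * (k%:~R * m%:R / N%:R))))); last first.
    by move=> m _; rewrite mxE -mulr_suml [RHS]mulrA.
  rewrite -mulr_sumr exchange_big; congr (_ * _); apply: eq_bigr => n _ /=.
  rewrite mulr_sumr; apply: eq_bigr => m _.
  rewrite mulrAC mulrC; congr (_ * _); rewrite (expi_modZ hN k m) -/j -2!expiMn -expiD.
  by congr expi; field.
under eq_bigr => n _.
  rewrite sum_roots_of_unity; last by have := ltn_ord j; have := ltn_ord n; lia.
  over.
rewrite (bigD1 j) //= subrr eqxx muln1 big1 ?addr0 => [|n nj].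
  by rewrite mulrC mulfK.
rewrite (_ : _ == 0 = false) ?muln0 ?mulr0 //.
by apply/negP => /eqP e; case/negP: nj; apply/eqP/val_inj => /=; lia.
Qed.

End DiscreteFourier.

(** * Shifted Fourier coefficients and absolutely convergent sums of samples *)

Section SampledSchwartz.
Set Implicit Arguments.
Unset Strict Implicit.
Local Open Scope classical_set_scope.
Context {R : realType}.
Local Notation Re := (@complex.Re R).
Local Notation Im := (@complex.Im R).
Notation mu := (@lebesgue_measure R).
Implicit Types (phi psi : R -> R[i]).

Lemma cintegralZ (c : R[i]) (f : R -> R[i]) : cintegrable f ->
  cintegral (fun t => c * f t) = c * cintegral f.
Proof.
move=> [fr fi].
have iZ (k : R) (g : R -> R) : mu.-integrable setT (EFin \o g) ->
    mu.-integrable setT (EFin \o (fun t => k * g t)).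
  by move=> ig; have := integrableZl measurableT k ig.
apply: complex_inj; rewrite /cintegral ?ReM ?ImM /=.
  rewrite -!RintegralZl // -RintegralB //; [|exact: iZ|exact: iZ].
  by apply: eq_Rintegral => t _; rewrite /= ReM.
rewrite -!RintegralZl // -RintegralD //; [|exact: iZ|exact: iZ].
by apply: eq_Rintegral => t _; rewrite /= ImM.
Qed.

Lemma cintegrable_expi phi (g : R -> R) : schwartz phi ->
  measurable_fun setT g -> cintegrable (fun t => phi t * expi (g t)).
Proof.
move=> sphi mg.
have mc : measurable_fun setT (cos \o g).
  by apply: measurableT_comp => //; exact: continuous_measurable_fun (@continuous_cos R).
have ms : measurable_fun setT (sin \o g).
  by apply: measurableT_comp => //; exact: continuous_measurable_fun (@continuous_sin R).
have [uc vc] := integrable_parts 0 ltr01 sphi mc (fun t => cos_max (g t)).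
have [us vs] := integrable_parts 0 ltr01 sphi ms (fun t => sin_max (g t)).
split.
  apply: eq_integrable (integrableB measurableT uc vs) => // t _ /=.
  by rewrite ReM.
apply: eq_integrable (integrableD measurableT us vc) => // t _ /=.
by rewrite ImM.
Qed.

(** Moving the origin of phases from [a] to 0 costs an exponential; for [a / P = m / N] it is the
    one of [dft_inversion]. *)
Lemma fcoef_fourier (a P : R) phi (k : int) : 0 < P -> schwartz phi ->
  fcoef a P phi k = expi (2 * pi * (k%:~R * (a / P))) * fourier phi (k%:~R / P).
Proof.
move=> P0 sphi; rewrite /fourier -cintegralZ; last first.
  apply: cintegrable_expi => //; apply: continuous_measurable_fun => t.
  by apply: cvgN; apply: cvgMr; exact: cvg_id.
rewrite /fcoef; congr cintegral; apply/funext => t.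
rewrite [RHS]mulrCA -expiD; congr (_ * expi _); rewrite /phase; field.
by rewrite gt_eqF.
Qed.

Lemma series_dominated (f g : nat -> R) (K : R) :
  (forall n, `|f n| <= K * g n) -> cvgn (series g) ->
  exists2 x : R, series f @ \oo --> x & `|x| <= K * limn (series g).
Proof.
move=> fg cg.
have cKg : series (fun n => K * g n) @ \oo --> K * limn (series g).
  have -> : series (fun n => K * g n) = (fun n => K * series g n).
    by apply/funext => n; rewrite /series /= mulr_sumr.
  by apply: cvgMr.
have cnf : cvgn [normed series f].
  apply: (@series_le_cvg _ _ (fun n => K * g n)) => //.
  - by move=> n; exact: normr_ge0.
  - by move=> n; exact: le_trans (normr_ge0 _) (fg n).
  by apply/cvg_ex; eexists; exact: cKg.
exists (limn (series f)); first exact: normed_cvg.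
apply: le_trans (lim_series_norm cnf) _.
rewrite -(cvg_lim _ cKg) //; apply: lim_series_le => //.
by apply/cvg_ex; eexists; exact: cKg.
Qed.

(** Comparison with an integral: for cells of length 1 the symmetric sums converge to the integral
    of the weight, hence are bounded, and they bound each half because all terms are nonnegative. *)
Lemma cvg_series_weight : cvgn (series (fun n => weight (Posz n) : R)) /\
  cvgn (series (fun n => weight (Negz n) : R)).
Proof.
have w1 l : `|weight l| <= 1 * weight l :> R.
  by rewrite mul1r ger0_norm ?weight_ge0.
have cv := cvg_step_total (a := 0) (ltr01 : 0 < 1 :> R) w1.
have /cvg_seq_bounded/bounded_fun_has_ubound [M hM] :
  cvgn (fun L => 1 * symsum (weight (R := R)) L) by apply/cvg_ex; eexists; exact: cv.
have bM L : symsum (weight (R := R)) L <= M by rewrite -[leLHS]mul1r; apply: hM; exists L.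
split; apply: nondecreasing_is_cvgn.
- by apply: nondecreasing_series => n _ _; exact: weight_ge0.
- exists M => _ [n _ <-]; apply: le_trans (bM n); rewrite /symsum lerDl.
  by apply: sumr_ge0 => i _; exact: weight_ge0.
- by apply: nondecreasing_series => n _ _; exact: weight_ge0.
- exists M => _ [n _ <-]; apply: le_trans (bM n); rewrite /symsum lerDr.
  by apply: sumr_ge0 => i _; exact: weight_ge0.
Qed.

Lemma sumZ_dominated : exists2 W : R, 0 <= W &
  forall (a : int -> R[i]) (K : R),
  (forall k, Normc.normc (a k) <= K * weight k) ->
  exists l m : R[i], sumZ_halves a l m /\ Normc.normc (l + m) <= K * W.
Proof.
have [cp cn] := cvg_series_weight.
set Wp := limn (series (fun n => weight (Posz n) : R)) in cp.
set Wn := limn (series (fun n => weight (Negz n) : R)) in cn.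
have Wp0 : 0 <= Wp.
  by apply: limr_ge => //; apply: nearW => n; apply: sumr_ge0 => i _; exact: weight_ge0.
have Wn0 : 0 <= Wn.
  by apply: limr_ge => //; apply: nearW => n; apply: sumr_ge0 => i _; exact: weight_ge0.
(* The factor 2 pays for bounding a modulus by the absolute values of the real and imaginary
   parts. *)
exists (2 * (Wp + Wn)); first by rewrite mulr_ge0 ?addr_ge0.
move=> a K aK.
have aR k : `|Re (a k)| <= K * weight k := le_trans (normc_Re _) (aK k).
have aI k : `|Im (a k)| <= K * weight k := le_trans (normc_Im _) (aK k).
have [pr cpr npr] := series_dominated (fun n => aR (Posz n)) cp.
have [pi cpi npi] := series_dominated (fun n => aI (Posz n)) cp.
have [nr cnr nnr] := series_dominated (fun n => aR (Negz n)) cn.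
have [ni cni nni] := series_dominated (fun n => aI (Negz n)) cn.
exists (pr +i* pi), (nr +i* ni); split.
  have eR z : (fun n => Re (series z n)) = series (fun n => Re (z n)).
    by apply/funext => n; exact: Re_series.
  have eI z : (fun n => Im (series z n)) = series (fun n => Im (z n)).
    by apply/funext => n; exact: Im_series.
  by split; split; rewrite ?eR ?eI.
apply: le_trans (normc_le_ReIm _) _; rewrite ReD ImD /=.
have := ler_normD pr nr; have := ler_normD pi ni.
by rewrite -/Wp in npr npi *; rewrite -/Wn in nnr nni *; lra.
Qed.

(** [C] is chosen before [phi], so one estimate yields both the summability of a comb and its
    continuity on Schwartz functions. *)
Lemma sumZ_samples (N : nat) (hN : (0 < N)%N) (w : 'rV[R[i]]_N) (d : R) : 0 < d ->
  exists2 C : R, 0 <= C & forall phi, schwartz phi -> exists l m : R[i],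
    sumZ_halves (fun k => w 0 (modZ hN k) * phi (k%:~R * d)) l m /\
    Normc.normc (l + m) <= C * (seminorm 0 0 phi + seminorm 2 0 phi).
Proof.
move=> d0; have [W W0 HW] := sumZ_dominated.
pose M := \sum_(i < N) Normc.normc (w 0 i).
have M0 : 0 <= M by apply: sumr_ge0 => i _; exact: normc_ge0.
have wM i : Normc.normc (w 0 i) <= M.
  by rewrite /M (bigD1 i) //= lerDl sumr_ge0 // => j _; exact: normc_ge0.
pose D := 2 + 3 * d^-1 ^+ 2 * (1 + 0 ^+ 2).
have D0 : 0 <= D by rewrite /D; have := sqr_ge0 d^-1; lra.
exists (M * D * W); first by rewrite !mulr_ge0.
move=> phi sphi; set S := seminorm 0 0 phi + seminorm 2 0 phi.
have S0 : 0 <= S by rewrite addr_ge0 // seminorm_ge0.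
have -> : M * D * W * S = M * D * S * W by ring.
apply: HW => k; rewrite Normc.normcM -!mulrA ler_pM ?normc_ge0 //.
rewrite -cderiv0 (le_trans (schwartz_decay 0 _ sphi)) // -/S mulrCA ler_wpM2l //.
(* The sample point [k d] is the node of index [k] for cells of length [d] centred from 0, so decay
   in [t] becomes decay in [k]. *)
have := oneDsqrV_le 0 d0 (k%:~R * d).
rewrite (_ : nearest 0 d (k%:~R * d) = k) //.
by rewrite mulrC -[d * _]add0r; exact: nearest_node.
Qed.

End SampledSchwartz.

(** * Temperedness of Dirac combs with periodic coefficients *)

Section PeriodicCombs.
Set Implicit Arguments.
Unset Strict Implicit.
Local Open Scope classical_set_scope.
Context {R : realType}.
Implicit Types (phi psi : R -> R[i]) (S T : @functional R).

Definition seminorm_sum (n : nat) phi : R :=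
  \sum_(p < n) \sum_(q < n) seminorm p q phi.

Lemma le_seminorm_sum phi m n : schwartz phi -> (m <= n)%N ->
  seminorm_sum m phi <= seminorm_sum n phi.
Proof.
move=> sphi; elim: n => [|n IH]; first by rewrite leqn0 => /eqP ->.
rewrite leq_eqVlt => /predU1P[-> //|]; rewrite ltnS => /IH /le_trans; apply.
rewrite /seminorm_sum big_ord_recr /= -[leLHS]addr0 lerD //.
  apply: ler_sum => p _; rewrite big_ord_recr /= lerDl.
  exact: seminorm_ge0.
by apply: sumr_ge0 => q _; exact: seminorm_ge0.
Qed.

Lemma le_sum3 (F : nat -> nat -> R) : (forall p q, 0 <= F p q) ->
  F 0%N 0%N + F 2%N 0%N <= \sum_(p < 3) \sum_(q < 3) F p q.
Proof.
move=> F0; rewrite !big_ord_recr !big_ord0 /= !add0r.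
move: (F0 0 1)%N (F0 0 2)%N (F0 1 0)%N (F0 1 1)%N (F0 1 2)%N (F0 2 1)%N (F0 2 2)%N; lra.
Qed.

Lemma seminorm02_le_sum phi : schwartz phi ->
  seminorm 0 0 phi + seminorm 2 0 phi <= seminorm_sum 3 phi.
Proof.
move=> sphi; apply: (le_sum3 (F := fun p q => seminorm p q phi)) => p q.
exact: seminorm_ge0.
Qed.

Lemma tempered_add S T : tempered S -> tempered T -> tempered (dist_add S T).
Proof.
move=> [linS [m [C SC]]] [linT [n [D TD]]]; split.
  move=> c phi psi sphi spsi; rewrite /dist_add linS // linT //; ring.
(* Raising the order enlarges the sum of seminorms, which keeps an upper bound valid only when its
   constant is nonnegative; hence the absolute values. *)
exists (maxn m n), (`|C| + `|D|) => phi sphi.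
have s0 k : 0 <= seminorm_sum k phi.
  by apply: sumr_ge0 => p _; apply: sumr_ge0 => q _; exact: seminorm_ge0.
have bound k c : (k <= maxn m n)%N -> c * seminorm_sum k.+1 phi <=
    `|c| * seminorm_sum (maxn m n).+1 phi.
  move=> km; apply: le_trans (ler_wpM2r (s0 _) (ler_norm c)) _.
  by rewrite ler_wpM2l // le_seminorm_sum.
apply: le_trans (le_normcD (S phi) (T phi)) _; rewrite mulrDl lerD //.
  exact: le_trans (SC _ sphi) (bound _ _ (leq_maxl _ _)).
exact: le_trans (TD _ sphi) (bound _ _ (leq_maxr _ _)).
Qed.

Lemma symsumZ (A : pzRingType) (c : A) (F : int -> A) (L : nat) :
  symsum (fun k => c * F k) L = c * symsum F L.
Proof. by rewrite /symsum mulrDr !mulr_sumr. Qed.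

Variables (N : nat) (hN : (0 < N)%N) (w : 'rV[R[i]]_N) (d : R) (d0 : 0 < d).

(** One definition for both sides: the offsets with spacing [fs^-1], and their DFT with spacing
    [fs / N]. *)
Definition comb (k : int) : functional :=
  dist_scale (w 0 (modZ hN k)) (dirac_delta (k%:~R * d)).

Lemma dist_summable_comb : dist_summable comb.
Proof.
move=> phi sphi; have [C _ HC] := sumZ_samples hN w d0.
by have [l [m [/sumZ_halvesP[] ]]] := HC _ sphi.
Qed.

Lemma tempered_comb : tempered (dist_sumZ comb).
Proof.
have [C C0 HC] := sumZ_samples hN w d0; split.
  move=> c phi psi sphi spsi.
  have [l [m [h1 _]]] := HC _ sphi; have [l' [m' [h2 _]]] := HC _ spsi.
  have h3 := sumZ_halvesD (sumZ_halvesZ c h1) h2.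
  rewrite /dist_sumZ /comb /dist_scale /dirac_delta.
  rewrite (sumZ_halvesP h1).2 (sumZ_halvesP h2).2.
  rewrite (_ : (fun k => _) = (fun k => c * (w 0 (modZ hN k) * phi (k%:~R * d)) +
    w 0 (modZ hN k) * psi (k%:~R * d))); last by apply/funext => k; ring.
  by rewrite (sumZ_halvesP h3).2; ring.
(* Order 2 lets the seminorm indices run below 3, which includes the pair (2, 0). *)
exists 2%N, C => phi sphi; have [l [m [h b]]] := HC _ sphi.
rewrite /dist_sumZ /comb /dist_scale /dirac_delta (sumZ_halvesP h).2.
apply: le_trans b _; rewrite ler_wpM2l //; exact: seminorm02_le_sum.
Qed.

End PeriodicCombs.

(** * The Fourier transform of a periodic comb *)

Section CombTransform.
Set Implicit Arguments.
Unset Strict Implicit.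
Local Open Scope classical_set_scope.
Context {R : realType}.

Lemma fourier_comb (N : nat) (hN : (0 < N)%N) (fs : R) (hfs : 0 < fs)
    (w : 'rV[R[i]]_N) (phi : R -> R[i]) : schwartz phi ->
  fs%:C * dist_sumZ (comb hN (dft w) (fs / N%:R)) phi =
  dist_sumZ (comb hN w fs^-1) (fourier phi).
Proof.
move=> sphi; have NR : (0 : R) < N%:R by rewrite ltr0n.
have d0 : 0 < fs / N%:R by rewrite divr_gt0.
(* One Poisson formula per residue: [a i / fs] is [i / N], the DFT frequency, and the nodes
   [a i + fs l] are the points [(i + N l) fs / N], all carrying the coefficient of index [i]. *)
pose a (i : 'I_N) : R := i%:R * (fs / N%:R).
have /choice [l /choice [m lm]] : forall i, exists l m, sumZ_halves (fcoef (a i) fs phi) l m /\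
    ccvg (fun L => fs%:C * symsum (phi \o node (a i) fs) L) (l + m).
  by move=> i; exact: poisson_summation.
have hl i := (lm i).1; have hs i := (lm i).2.
have time_side : dist_sumZ (comb hN w fs^-1) (fourier phi) =
    \sum_i dft w 0 i * (l i + m i).
  have h := sumZ_halves_sum (index_enum _) (fun i => sumZ_halvesZ (dft w 0 i) (hl i)).
  rewrite (eq_bigr _ (fun i _ => mulrDr _ _ _)) big_split /= -(sumZ_halvesP h).2.
  congr sumZ; apply/funext => k.
  rewrite /comb /dist_scale /dirac_delta -(dft_inversion hN w k) mulr_suml.
  apply: eq_bigr => i _; rewrite (fcoef_fourier (a i) k hfs sphi) mulrA.
  congr (_ * expi _ * _); rewrite /a; field.
  by rewrite !gt_eqF.
rewrite time_side.
have [C _ HC] := sumZ_samples hN (dft w) d0.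
have [l' [m' [h _]]] := HC _ sphi.
rewrite /dist_sumZ /comb /dist_scale /dirac_delta (sumZ_halvesP h).2.
(* Symmetric sums of length [L * N] split evenly into the [N] residue classes. The whole sequence is
   already known to converge, so this subsequence determines its limit. *)
have hN' : (fun L => L * N)%N @ \oo --> \oo.
  exact: cvg_mulnr.
apply: ccvg_unique (ccvgZ fs%:C (ccvg_comp hN' (ccvg_symsum h))) _.
have := ccvg_sum (index_enum _) (fun i => ccvgZ (dft w 0 i) (hs i)).
congr ccvg; apply/funext => L /=.
rewrite symsum_blocks mulr_sumr; apply: eq_bigr => i _.
rewrite mulrCA; congr (_ * _); rewrite -symsumZ.
congr symsum; apply/funext => k /=.
have -> : modZ hN (i%:Z + k * N%:Z) = i.
  apply/val_inj; rewrite /modZ /= addrC modzMDl modz_small //.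
  by rewrite /= ltz_nat ltn_ord.
congr (_ * phi _); rewrite /node /a intrD intrM -!pmulrn; field.
by rewrite gt_eqF.
Qed.

End CombTransform.

Theorem mainTheorem1 (R : realType) (N : nat) (hN : (0 < N)%N)
  (fs : R) (hfs : 0 < fs)
  (x : R -> R[i]) (X : functional) (hX : is_signal_fourier x X)
  (o : 'rV[R]_N)
  (hsamples : dist_summable (fun k : int => dist_mul x (dirac_delta (k%:~R / fs))))
  (Yid : functional) :
  let yid := dist_mul x (dist_sumZ (fun k : int => dirac_delta (k%:~R / fs))) in
  let offsets := fun k : int =>
    dist_scale (o 0 (modZ hN k))%:C (dirac_delta (k%:~R / fs)) in
  let yo := dist_add yid (dist_sumZ offsets) in
  let lines := fun k : int =>
    dist_scale (dft (map_mx (fun r : R => r%:C) o) 0 (modZ hN k))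
           (dirac_delta (k%:~R * (fs / N%:R))) in
  is_fourier yid Yid ->
  [/\ dist_summable offsets,
      dist_summable lines
    & is_fourier yo (dist_add Yid (dist_scale fs%:C (dist_sumZ lines)))].
Proof.
move=> yid offsets yo lines Yid_yid.
have fs0 : 0 < fs^-1 by rewrite invr_gt0.
have fsN : 0 < fs / N%:R by rewrite divr_gt0 // ltr0n.
have offsetsE : offsets = comb hN (map_mx (fun r : R => r%:C) o) fs^-1.
  by apply/funext => k; rewrite /offsets /comb mxE.
have linesE : lines = comb hN (dft (map_mx (fun r : R => r%:C) o)) (fs / N%:R).
  by [].
have [tyid Yid_phi] := Yid_yid.
split.
- by rewrite offsetsE; exact: dist_summable_comb.
- by rewrite linesE; exact: dist_summable_comb.
(* The transform is defined by duality, so it is additive: [yid] brings its temperedness and its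
   transform from the hypothesis, and only the comb of offsets remains. *)
split; first by rewrite /yo offsetsE; apply: tempered_add tyid (tempered_comb _ _ _).
move=> phi sphi; rewrite /yo /dist_add /dist_scale linesE offsetsE.
by rewrite Yid_phi // fourier_comb.
Qed.
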